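(* Fix $k<m$. Let $V=0\times\mathbb R^{m-1}\subset\mathbb R^m$, regarded as a constant hyperplane field on $I^m$, and let $\sigma:I^m\to J^r(\mathbb R^m,\mathbb R^n)$ be a section such that $\sigma=0$ on an open neighborhood of $\partial I^m$ and $\sigma^\perp=0$ on all of $I^m$ with respect to $V$. Then for every $\varepsilon>0$ there exist an isotopy $F_t:I^m\to I^m$ and a holonomic section $\hat\sigma$ such that: $\mathrm{dist}_{C^0}(\hat\sigma,\sigma)<\varepsilon$ on an open neighborhood of $F_1(I^k)$; $\|\hat\sigma^\perp\|_{C^0}<\varepsilon$ on all of $I^m$; $\mathrm{dist}_{C^0}(F_t,\mathrm{id})<\varepsilon$; $F_t=\mathrm{id}_{I^m}$ and $\hat\sigma=0$ on an open neighborhood of $\partial I^m$; and $V$ is invariant under $F_t$ (i.e. $dF_t(V)=V$).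
   Context: $I=[-1,1]$, $I^k=I^k\times\{0\}^{m-k}\subset I^m$. $J^r(\mathbb R^m,\mathbb R^n)\cong\mathbb R^m\times(\mathcal P_r)^n$ via Taylor polynomials of degree $\le r$; $0$ is the jet of the zero map; holonomic means of the form $j^r(h)$. For the hyperplane field $V$, $\sigma^\perp$ of $j^r(h)(x)$ consists of the $(r-1)$-jet of $h$ and all derivatives $\partial_\nu\partial_\alpha h(x)$ with $|\alpha|=r-1$, $\nu\in V$; equivalently, all partial derivatives of order $\le r$ except the pure derivative $\partial_1^r$. *)

(* Defs.v *)
From HB Require Import structures.
From mathcomp Require Import all_boot all_order all_algebra.
From mathcomp Require Import all_classical all_reals all_analysis.
Unset Printing Implicit Defensive.
Import Order.TTheory GRing.Theory Num.Theory.
Import numFieldNormedType.Exports.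
Local Open Scope classical_set_scope.
Local Open Scope ring_scope.

Section Defs.
Variable R : realType.

Definition cube (m : nat) : set 'rV[R]_m :=
  [set x | forall i : 'I_m, -1 <= x ord0 i <= 1].

Definition cube_bdry (m : nat) : set 'rV[R]_m :=
  [set x | cube m x /\ exists i : 'I_m, `|x ord0 i| = 1].

Definition cube_k (m k : nat) : set 'rV[R]_m :=
  [set x | cube m x /\ forall i : 'I_m, (k <= i)%N -> x ord0 i = 0].

Definition Vhyp (m : nat) : set 'rV[R]_m :=
  [set v | forall i : 'I_m, val i = 0%N -> v ord0 i = 0].

Definition evec (p : nat) (i : 'I_p) : 'rV[R]_p := delta_mx ord0 i.

Definition pder (p : nat) (W : normedModType R) (i : 'I_p)
  (f : 'rV[R]_p -> W) : 'rV[R]_p -> W := fun x => 'D_(evec p i) f x.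

Definition iter_pder (p : nat) (W : normedModType R) (s : seq 'I_p)
  (f : 'rV[R]_p -> W) : 'rV[R]_p -> W := foldr (@pder p W) f s.

Definition smooth (p : nat) (W : normedModType R) (f : 'rV[R]_p -> W) :=
  forall (s : seq 'I_p) (x : 'rV[R]_p), differentiable (iter_pder p W s f) x.

Definition mdeg (m : nat) (a : 'I_m -> nat) : nat := (\sum_(i < m) a i)%N.

Definition pder_multi (m : nat) (a : 'I_m -> nat) (f : 'rV[R]_m -> R)
  : 'rV[R]_m -> R :=
  iter_pder m R^o (flatten [seq nseq (a i) i | i <- enum 'I_m]) f.

(* a (fibre part of a) section of J^r(R^m,R^n): value sigma x a j is the
   component of the jet at x indexed by the multi-index a (|a| <= r) and
   the output coordinate j; components with |a| > r are irrelevant. *)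
Definition jsection (m n : nat) := 'rV[R]_m -> ('I_m -> nat) -> 'I_n -> R.

Definition jet (m n : nat) (h : 'rV[R]_m -> 'rV[R]_n) : jsection m n :=
  fun x a j => pder_multi m a (fun y => h y ord0 j) x.

(* indices belonging to sigma^perp : all |a| <= r except the pure d_1^r *)
Definition perp_index (m r : nat) (a : 'I_m -> nat) : Prop :=
  (mdeg m a <= r)%N /\ exists i : 'I_m, a i <> (if val i == 0%N then r else 0%N).

Definition isotopy (m : nat) (F : R -> 'rV[R]_m -> 'rV[R]_m) : Prop :=
  (exists G : 'rV[R]_(1 + m) -> 'rV[R]_m, smooth (1 + m) _ G /\
     forall t x, F t x = G (row_mx (const_mx t) x)) /\
  (forall x, cube m x -> F 0 x = x) /\
  (forall t, 0 <= t <= 1 ->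
     [/\ set_bij (cube m) (cube m) (F t) &
         forall x, cube m x -> injective (fun v => 'D_v (F t) x)]).

End Defs.
Arguments cube {R} m.
Arguments evec {R p}.
Arguments pder {R p W}.
Arguments iter_pder {R p W}.
Arguments smooth {R p W}.
Arguments mdeg {m}.
Arguments pder_multi {R m}.
Arguments jet {R m n}.
Arguments perp_index {m}.
Arguments isotopy {R m}.
Arguments cube_bdry {R} m.
Arguments cube_k {R} m k.
Arguments Vhyp {R} m.

(* Main.v *)
Require Import Defs.
From HB Require Import structures.
From mathcomp Require Import all_boot all_order all_algebra.
From mathcomp Require Import all_classical all_reals all_analysis.
From mathcomp Require Import ring lra.
Import Order.TTheory GRing.Theory Num.Theory.
Import numFieldNormedType.Exports.
Local Open Scope classical_set_scope.
Local Open Scope ring_scope.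

(* Only the component s of sigma along the pure derivative d_0^r is nonzero
   (coordinates are numbered from 0).  Let y be the last coordinate, which
   vanishes on I^k, let S be a smooth approximation of s supported in the
   interior of the cube, and put
     h = S * l^r * (2 (y / del) c_r(x_0 / l) - 2^-r c_r(2 x_0 / l)),
   where c_r is the r-th antiderivative cos(. - r pi / 2) of cos.  Every
   derivative of h of order <= r is O(l) except
     d_0^r h = S * (2 (y / del) cos(x_0 / l) - cos(2 x_0 / l)) + O(l),
   and the bracket is identically 1 on the graph y = del * cos(x_0 / l), because
   2 cos^2 u - cos 2u = 1.  So it suffices to push I^k onto this graph (cut off
   near the boundary) by a shear in the y-direction, which preserves x_0 and
   hence V.  One chooses S first, then del, then l.  When k = 0 the set I^k is
   the origin: the identity and h = S * l^r * c_r(x_0 / l) do. *)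

Set Implicit Arguments.
Unset Strict Implicit.

(** * Smooth functions *)

Section SmoothCalculus.
Context {R : realType}.

Section Basics.
Context {p : nat} {W : normedModType R}.
Implicit Types (f g : 'rV[R]_p -> W) (s : seq 'I_p).

(** Bounding the order of the derivatives makes the closure properties provable by induction on
    [N]. *)
Definition diff_upto (N : nat) f :=
  forall s x, (size s <= N)%N -> differentiable (iter_pder s f) x.

Lemma smooth_diff_upto f : smooth f <-> forall N, diff_upto N f.
Proof. by split=> [sf N s x _|sf s x]; [exact: sf|exact: (sf (size s))]. Qed.

Lemma iter_pder_rcons s i f : iter_pder (rcons s i) f = iter_pder s (pder i f).
Proof. by rewrite /iter_pder foldr_rcons. Qed.

Lemma iter_pder_cat s1 s2 f :
  iter_pder (s1 ++ s2) f = iter_pder s1 (iter_pder s2 f).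
Proof. by rewrite /iter_pder foldr_cat. Qed.

(** The innermost derivative is split off, since [foldr] applies the last entry of [s] first;
    closure proofs then only need a rule for a single derivative. *)
Lemma diff_uptoS N f : diff_upto N.+1 f <->
  (forall x, differentiable f x) /\ forall i, diff_upto N (pder i f).
Proof.
split=> [sf|[df sf] s x].
  split=> [x|i s x hs]; first exact: (sf [::] x).
  by rewrite -iter_pder_rcons; apply: sf; rewrite size_rcons.
case/lastP: s => [|s i]; first by move=> _; exact: df.
by rewrite size_rcons iter_pder_rcons => hs; exact: sf.
Qed.

Lemma diff_uptoW N f : diff_upto N.+1 f -> diff_upto N f.
Proof. by move=> sf s x hs; apply: sf; exact: leqW. Qed.

Lemma diff_upto_diff N f x : diff_upto N f -> differentiable f x.
Proof. by move=> /(_ [::] x); exact. Qed.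

Lemma smooth_diff f x : smooth f -> differentiable f x.
Proof. by move=> /(_ [::] x). Qed.

Lemma smooth_iter_pder s f : smooth f -> smooth (iter_pder s f).
Proof. by move=> sf t x; rewrite -iter_pder_cat; exact: sf. Qed.

Lemma smooth_pder i f : smooth f -> smooth (pder i f).
Proof. exact: (@smooth_iter_pder [:: i]). Qed.

Lemma smooth_continuous f : smooth f -> continuous f.
Proof. by move=> sf x; exact/differentiable_continuous/smooth_diff. Qed.

Lemma pder_cst i (w : W) : pder i (fun _ : 'rV[R]_p => w) = fun=> 0.
Proof. by apply/funext => x; rewrite /pder derive_cst. Qed.

Lemma pderD i f g : (forall x, differentiable f x) ->
  (forall x, differentiable g x) ->
  pder i (fun x => f x + g x) = fun x => pder i f x + pder i g x.
Proof.
by move=> df dg; apply/funext => x; rewrite /pder deriveD//; exact: diff_derivable.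
Qed.

Lemma pderZ i (c : R) f : (forall x, differentiable f x) ->
  pder i (fun x => c *: f x) = fun x => c *: pder i f x.
Proof.
by move=> df; apply/funext => x; rewrite /pder deriveZ//; exact: diff_derivable.
Qed.

Lemma diff_upto_cst N (w : W) : diff_upto N (fun _ => w).
Proof.
elim: N w => [|N IH] w; first by case=> // x _; exact: differentiable_cst.
apply/diff_uptoS; split=> [x|i]; first exact: differentiable_cst.
by rewrite pder_cst; exact: IH.
Qed.

Lemma diff_uptoD N f g : diff_upto N f -> diff_upto N g ->
  diff_upto N (fun x => f x + g x).
Proof.
elim: N f g => [|N IH] f g sf sg.
  by case=> // x _; apply: differentiableD; exact: (@diff_upto_diff 0%N).
apply/diff_uptoS; split=> [x|i].
  by apply: differentiableD; exact: (@diff_upto_diff N.+1).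
rewrite pderD//; try by move=> x; exact: (@diff_upto_diff N.+1).
by apply: IH; [move/diff_uptoS: sf => []|move/diff_uptoS: sg => []].
Qed.

Lemma diff_uptoZ N (c : R) f : diff_upto N f -> diff_upto N (fun x => c *: f x).
Proof.
elim: N f => [|N IH] f sf.
  by case=> // x _; apply: differentiableZ; exact: (@diff_upto_diff 0%N).
apply/diff_uptoS; split=> [x|i].
  by apply: differentiableZ; exact: (@diff_upto_diff N.+1).
rewrite pderZ//; try by move=> x; exact: (@diff_upto_diff N.+1).
by apply: IH; move/diff_uptoS: sf => [].
Qed.

Lemma smooth_cst (w : W) : smooth (fun _ : 'rV[R]_p => w).
Proof. by apply/smooth_diff_upto => N; exact: diff_upto_cst. Qed.

Lemma smoothD f g : smooth f -> smooth g -> smooth (fun x => f x + g x).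
Proof.
by move=> /smooth_diff_upto sf /smooth_diff_upto sg; apply/smooth_diff_upto => N; exact: diff_uptoD.
Qed.

Lemma smoothZ c f : smooth f -> smooth (fun x => c *: f x).
Proof.
by move=> /smooth_diff_upto sf; apply/smooth_diff_upto => N; exact: diff_uptoZ.
Qed.

Lemma smooth_sum (I : Type) (r : seq I) (P : pred I) (F : I -> 'rV[R]_p -> W) :
  (forall i, smooth (F i)) -> smooth (fun x => \sum_(i <- r | P i) F i x).
Proof.
move=> sF; elim: r => [|i r IH].
  by under eq_fun do rewrite big_nil; exact: smooth_cst.
by under eq_fun do rewrite big_cons; case: (P i) => //; exact: smoothD.
Qed.

Lemma iter_pderD s f g : smooth f -> smooth g ->
  iter_pder s (fun x => f x + g x) = fun x => iter_pder s f x + iter_pder s g x.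
Proof.
move=> sf sg; elim: s => //= i s ->.
by rewrite pderD.
Qed.

Lemma iter_pderZ s c f : smooth f ->
  iter_pder s (fun x => c *: f x) = fun x => c *: iter_pder s f x.
Proof. by move=> sf; elim: s => //= i s ->; rewrite pderZ// => x; exact: sf. Qed.

Lemma iter_pder_near0 s f (U : set 'rV[R]_p) : open U ->
  (forall x, U x -> f x = 0) -> forall x, U x -> iter_pder s f x = 0.
Proof.
move=> oU f0; elim: s => //= i s IH x Ux.
rewrite /pder (@near_eq_derive _ _ _ _ (cst 0)) ?derive_cst//.
by apply: filterS (open_nbhs_nbhs (conj oU Ux)) => y; exact: IH.
Qed.

End Basics.

Section Scalar.
Context {p : nat}.
Implicit Types (f g : 'rV[R]_p -> R^o) (s : seq 'I_p).

Lemma pderM i f g : (forall x, differentiable f x) ->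
  (forall x, differentiable g x) ->
  pder i (fun x => f x * g x : R^o) =
  fun x => f x * pder i g x + pder i f x * g x.
Proof.
move=> df dg; apply/funext => x; rewrite /pder.
rewrite (@deriveM _ _ f g)//; try exact: diff_derivable.
by rewrite [X in _ + X]mulrC.
Qed.

Lemma diff_uptoM N f g : diff_upto N f -> diff_upto N g ->
  diff_upto N (fun x => f x * g x : R^o).
Proof.
elim: N f g => [|N IH] f g sf sg.
  by case=> // x _; apply: (@differentiableM _ _ f g); exact: (@diff_upto_diff _ _ 0%N).
apply/diff_uptoS; split=> [x|i].
  by apply: (@differentiableM _ _ f g); exact: (@diff_upto_diff _ _ N.+1).
rewrite pderM//; try by move=> x; exact: (@diff_upto_diff _ _ N.+1).
move/diff_uptoS: (sf) => [_ sf']; move/diff_uptoS: (sg) => [_ sg'].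
by apply: diff_uptoD; apply: IH => //; exact: diff_uptoW.
Qed.

(** Since (1/f)' = -f' (1/f)^2, the derivative is a product of a derivative of [f] and inverses
    covered by the induction hypothesis. *)
Lemma diff_uptoV N f : (forall x, f x != 0) -> diff_upto N f ->
  diff_upto N (fun x => (f x)^-1 : R^o).
Proof.
move=> f0; elim: N => [|N IH] sf.
  by case=> // x _; apply: differentiableV => //; exact: (@diff_upto_diff _ _ 0%N).
apply/diff_uptoS; split=> [x|i].
  by apply: differentiableV => //; exact: (@diff_upto_diff _ _ N.+1).
have -> : pder i (fun x => (f x)^-1 : R^o) =
    fun x => (-1 : R) *: (pder i f x * ((f x)^-1 * (f x)^-1) : R^o).
  apply/funext => x; rewrite /pder deriveV//; last first.
    by apply: diff_derivable; exact: (@diff_upto_diff _ _ N.+1).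
  by rewrite /GRing.scale /= mulN1r mulNr expr2 invfM mulrC.
move/diff_uptoS: (sf) => [_ sf']; apply: diff_uptoZ; apply: diff_uptoM => //.
by apply: diff_uptoM; apply: IH; exact: diff_uptoW.
Qed.

Lemma smoothM f g : smooth f -> smooth g -> smooth (fun x => f x * g x : R^o).
Proof.
by move=> /smooth_diff_upto sf /smooth_diff_upto sg; apply/smooth_diff_upto => N; exact: diff_uptoM.
Qed.

Lemma smoothV f : (forall x, f x != 0) -> smooth f ->
  smooth (fun x => (f x)^-1 : R^o).
Proof.
by move=> f0 /smooth_diff_upto sf; apply/smooth_diff_upto => N; exact: diff_uptoV.
Qed.

Lemma smooth_prod (I : Type) (r : seq I) (P : pred I) (F : I -> 'rV[R]_p -> R^o) :
  (forall i, smooth (F i)) -> smooth (fun x => \prod_(i <- r | P i) F i x : R^o).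
Proof.
move=> sF; elim: r => [|i r IH].
  by under eq_fun do rewrite big_nil; exact: smooth_cst.
by under eq_fun do rewrite big_cons; case: (P i) => //; exact: smoothM.
Qed.

Lemma diff_uptoZl N (W : normedModType R) f (w : W) :
  diff_upto N f -> diff_upto N (fun x => f x *: w).
Proof.
elim: N f => [|N IH] f sf.
  by case=> // x _; apply: differentiableZl; exact: (@diff_upto_diff _ _ 0%N).
apply/diff_uptoS; split=> [x|i].
  by apply: differentiableZl; exact: (@diff_upto_diff _ _ N.+1).
have -> : pder i (fun x => f x *: w) = fun x => pder i f x *: w.
  apply/funext => x; rewrite /pder deriveE; last first.
    by apply: differentiableZl; exact: (@diff_upto_diff _ _ N.+1).
  rewrite diffZl; last exact: (@diff_upto_diff _ _ N.+1).
  by rewrite deriveE//; exact: (@diff_upto_diff _ _ N.+1).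
by apply: IH; move/diff_uptoS: sf => [].
Qed.

Lemma smoothZl (W : normedModType R) f (w : W) :
  smooth f -> smooth (fun x => f x *: w).
Proof.
by move=> /smooth_diff_upto sf; apply/smooth_diff_upto => N; exact: diff_uptoZl.
Qed.

Lemma coord_evec (i j : 'I_p) : (evec i : 'rV[R]_p) ord0 j = (j == i)%:R.
Proof. by rewrite /evec mxE eqxx. Qed.

Lemma is_derive_coord i (x v : 'rV[R]_p) :
  is_derive x v (fun y : 'rV[R]_p => y ord0 i : R^o) (v ord0 i).
Proof.
apply: DeriveDef; first exact/diff_derivable/differentiable_coord.
have h := derive_mx (@derivable_id R _ x v).
by move/matrixP: h => /(_ ord0 i); rewrite derive_id mxE => <-.
Qed.

Lemma differentiable_affine_coord (u : R -> R) (a b : R) (i : 'I_p) (x : 'rV[R]_p) :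
  (forall z, derivable u z 1) ->
  differentiable (fun y : 'rV[R]_p => u (a * y ord0 i + b) : R^o) x.
Proof.
move=> du; apply: (@differentiable_comp _ _ R^o R^o
  (fun y : 'rV[R]_p => a * y ord0 i + b : R^o) (u : R^o -> R^o)); last first.
  exact/derivable1_diffP.
apply: (@differentiableD _ _ R^o (fun y : 'rV[R]_p => a * y ord0 i : R^o) (cst b));
  last exact: differentiable_cst.
apply: (@differentiableZ _ _ R^o (fun y : 'rV[R]_p => y ord0 i : R^o) a).
exact: differentiable_coord.
Qed.

Lemma pder_affine_coord (u u' : R -> R) (a b : R) (i j : 'I_p) :
  (forall z : R, is_derive z 1 u (u' z)) ->
  pder j (fun y : 'rV[R]_p => u (a * y ord0 i + b) : R^o) =
  fun y => (a * (i == j)%:R) * u' (a * y ord0 i + b).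
Proof.
move=> du; apply/funext => x; rewrite /pder.
have dl : differentiable (fun y : 'rV[R]_p => a * y ord0 i + b : R^o) x.
  apply: (@differentiableD _ _ R^o (fun y : 'rV[R]_p => a * y ord0 i : R^o) (cst b));
    last exact: differentiable_cst.
  apply: (@differentiableZ _ _ R^o (fun y : 'rV[R]_p => y ord0 i : R^o) a).
  exact: differentiable_coord.
have du' z : derivable u z 1 by have [] := du z.
rewrite deriveE; last exact: differentiable_affine_coord.
rewrite (@diff_comp _ _ R^o R^o
  (fun y : 'rV[R]_p => a * y ord0 i + b : R^o) (u : R^o -> R^o))//; last first.
  exact/derivable1_diffP.
rewrite /= diff1E; last exact/derivable1_diffP.
rewrite derive1E derive_val -deriveE// /GRing.scale /=; congr (_ * _).
have h := is_derive_coord i x (evec j).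
have -> : 'D_(evec j) (fun y : 'rV[R]_p => a * y ord0 i + b : R^o) x =
   a *: 'D_(evec j) (fun y : 'rV[R]_p => y ord0 i : R^o) x.
  have h1 := @is_deriveZ _ _ _ _ a _ _ _ h.
  have := @is_deriveD _ _ _ _ _ _ _ _ _ h1 (@is_derive_cst _ _ R^o (b : R^o) x (evec j)).
  by move=> [_ hh]; rewrite [LHS]hh addr0; have [_ ->] := h.
by have [_ ->] := h; rewrite coord_evec.
Qed.

(** A family whose derivatives are finite linear combinations of its own members, with coefficients
    and indices listed in [d], is smooth by induction on the order. This serves for coordinates,
    cosines and the flat functions below. *)
Lemma smooth_affine_coord (J : Type) (u : J -> R -> R)
  (d : J -> seq (R * J)) (a b : R) (i : 'I_p) (k : J) :
  (forall k (z : R), is_derive z 1 (u k) (\sum_(c <- d k) c.1 * u c.2 z)) ->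
  smooth (fun y : 'rV[R]_p => u k (a * y ord0 i + b) : R^o).
Proof.
move=> du; apply/smooth_diff_upto => N; elim: N k => [|N IH] k.
  by case=> // x _; apply: differentiable_affine_coord => z; have [] := du k z.
apply/diff_uptoS; split=> [x|j].
  by apply: differentiable_affine_coord => z; have [] := du k z.
rewrite (pder_affine_coord a b i j (du k)).
apply: diff_uptoM; first exact: diff_upto_cst.
elim: (d k) => [|c r IHr]; first by under eq_fun do rewrite big_nil; exact: diff_upto_cst.
under eq_fun do rewrite big_cons; apply: diff_uptoD => //.
by apply: diff_uptoM; [exact: diff_upto_cst|exact: IH].
Qed.

Lemma smooth_coord (i : 'I_p) : smooth (fun y : 'rV[R]_p => y ord0 i : R^o).
Proof.
(* The family consists of the identity and the constant 1. *)
have : forall (k : bool) (z : R), is_derive z 1 (fun z => if k then z else 1)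
   (\sum_(c <- (if k then [:: (1, false)] else [::])) c.1 * (if c.2 then z else 1) : R).
  by move=> [] z; rewrite ?big_seq1 ?big_nil /= ?mulr1; typeclasses eauto.
move=> /(smooth_affine_coord 1 0 i true).
by under eq_fun do rewrite mul1r addr0.
Qed.

Lemma smooth_cos_coord (a b : R) (i : 'I_p) :
  smooth (fun y : 'rV[R]_p => cos (a * y ord0 i + b) : R^o).
Proof.
apply: (@smooth_affine_coord bool (fun k : bool => if k then cos else sin)
  (fun k => if k then [:: (-1, false)] else [:: (1, true)]) a b i true).
by move=> [] z; rewrite big_seq1 /= ?mulN1r ?mul1r; typeclasses eauto.
Qed.

(** Writing the derivative as a phase shift by pi/2 instead of a sine keeps all derivatives among
    cosines with a phase. *)
Lemma pder_cos_coord (a b : R) (i j : 'I_p) :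
  pder j (fun y : 'rV[R]_p => cos (a * y ord0 i + b) : R^o) =
  fun y => (a * (i == j)%:R) * cos (a * y ord0 i + (b + pi / 2)).
Proof.
rewrite (pder_affine_coord a b i j (@is_derive_cos R)).
by apply/funext => y; rewrite addrA cosDpihalf.
Qed.

End Scalar.

(** Used to view a function of space as a smooth function of time and space. Each basis vector
    projects to zero or to a basis vector, so the induction stays among functions of the same
    form. *)
Lemma smooth_rsubmx (p : nat) (W : normedModType R) (f : 'rV[R]_p -> W) :
  smooth f -> smooth (fun z : 'rV[R]_(1 + p) => f (rsubmx z)).
Proof.
move=> /smooth_diff_upto sf; apply/smooth_diff_upto => N.
elim: N f sf => [|N IH] f sf.
  case=> // x _; apply: differentiable_comp; first exact: differentiable_rsubmx.
  exact: (@diff_upto_diff _ _ 0%N).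
apply/diff_uptoS; split=> [x|i].
  apply: differentiable_comp; first exact: differentiable_rsubmx.
  exact: (@diff_upto_diff _ _ 0%N).
have df x : differentiable f x by exact: (@diff_upto_diff _ _ 0%N).
have dE : pder i (fun z : 'rV[R]_(1 + p) => f (rsubmx z)) =
    fun z => 'D_(rsubmx (evec i : 'rV[R]_(1 + p))) f (rsubmx z).
  apply/funext => z.
  have E (h : R) : rsubmx (h *: evec i + z) = h *: rsubmx (evec i : 'rV[R]_(1 + p)) + rsubmx z.
    by apply/rowP => k; rewrite !mxE.
  have /funext E' : (fun h : R => h^-1 *: (f (rsubmx (h *: evec i + z)) - f (rsubmx z))) =1
    (fun h : R => h^-1 *: (f (h *: rsubmx (evec i : 'rV[R]_(1 + p)) + rsubmx z) - f (rsubmx z))).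
    by move=> h; rewrite E.
  (* Both derivatives are limits of the same difference quotients. *)
  exact: (congr1 (fun F : R -> W => lim (F @ 0^')) E').
rewrite dE; case: (split_ordP i) => j ->.
  have -> : rsubmx (evec (lshift p j) : 'rV[R]_(1 + p)) = 0.
    by apply/rowP => k; rewrite !mxE eq_rlshift andbF.
  by under eq_fun do rewrite derive0; exact: diff_upto_cst.
have -> : rsubmx (evec (rshift 1 j) : 'rV[R]_(1 + p)) = evec j.
  by apply/rowP => k; rewrite !mxE eq_rshift.
apply: (IH (pder j f)) => N'.
by have /diff_uptoS[] := sf N'.+1.
Qed.

End SmoothCalculus.

(** * A smooth step and a partition of unity on the line *)

Section SmoothStep.
Context {R : realType}.

(** The powers [k] are treated together because differentiation leads from [k] to [k.+1] and
    [k.+2]. *)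
Definition flat (k : nat) (z : R) : R :=
  if 0 < z then z^-1 ^+ k * expR (- z^-1) else 0.

Lemma flat_le0 k z : z <= 0 -> flat k z = 0.
Proof. by rewrite /flat ltNge => ->. Qed.

Lemma flat_ge0 k z : 0 <= flat k z.
Proof.
rewrite /flat; case: ifP => // z0.
by rewrite mulr_ge0 ?expR_ge0// exprn_ge0// invr_ge0 ltW.
Qed.

Lemma flat_gt0 k z : 0 < z -> 0 < flat k z.
Proof. by move=> z0; rewrite /flat z0 mulr_gt0 ?expR_gt0// exprn_gt0// invr_gt0. Qed.

(** With w = 1/z this follows from exp w >= w^(k+2) / (k+2)!. The quadratic decay makes the
    derivative at the origin exist and vanish. *)
Lemma flat_le k : exists C : R, forall z, flat k z <= C * z ^+ 2.
Proof.
exists (k.+2`!%:R) => z; rewrite /flat; case: ifP => [z0|_]; last first.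
  by rewrite mulr_ge0// sqr_ge0.
set w := z^-1; have w0 : 0 < w by rewrite invr_gt0.
have -> : z = w^-1 by rewrite invrK.
clearbody w.
have /(@expR_ge1Dxn R _ k.+1) h : 0 <= w by exact: ltW.
have {h} : w ^+ k.+2 / k.+2`!%:R <= expR w by apply: le_trans h; rewrite lerDr.
rewrite ler_pdivrMr ?ltr0n ?fact_gt0// => h.
rewrite expRN exprVn.
rewrite ler_pdivrMr ?expR_gt0//. rewrite mulrAC ler_pdivlMr ?exprn_gt0//.
by rewrite -exprD addn2 mulrC.
Qed.

Lemma is_derive_flat_pos k (z : R) : 0 < z ->
  is_derive z 1 (flat k) (- k%:R * flat k.+1 z + flat k.+2 z).
Proof.
move=> z0; have zn0 : z != 0 by rewrite gt_eqF.
apply: (@near_eq_is_derive _ _ _ ((fun y : R => y^-1) ^+ k * (expR \o (fun y => - y^-1)))).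
  near=> y; have y0 : 0 < y by near: y; exact: lt_nbhsr.
  by rewrite /flat y0 fctE exprfctE.
have dV : is_derive z (1 : R) (fun y : R => y^-1) (- z ^- 2 : R).
  apply: DeriveDef; first exact: (@derivableV _ _ id).
  by rewrite (@deriveV _ _ id)// derive_id /GRing.scale/= mulr1.
have dE : is_derive z 1 (expR \o (fun y => - y^-1)) (z ^- 2 * expR (- z^-1)).
  have dN := is_deriveN dV.
  have := @is_derive1_comp R expR (fun y => - y^-1) z _ _ (is_derive_expR (- z^-1)) dN.
  by rewrite opprK mulrC.
have := is_deriveM (is_deriveX k dV) dE.
move=> H; apply: (is_derive_eq H).
rewrite /flat z0 -exprVn exprfctE; set w := z^-1; set e := expR _.
change (w ^+ k * (w ^+ 2 * e) + e * (k%:R * w ^+ k.-1 * - w ^+ 2) =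
  - k%:R * (w ^+ k.+1 * e) + w ^+ k.+2 * e).
(* At [k = 0] the predecessor in the power rule truncates, but the coefficient [k%:R] kills that
   term. *)
case: k {H} => [|k]; rewrite ?succnK !exprS; first by rewrite !expr0; ring.
by ring.
Unshelve. all: by end_near. Qed.

Lemma is_derive_flat k (z : R) :
  is_derive z 1 (flat k) (- k%:R * flat k.+1 z + flat k.+2 z).
Proof.
have [z0|z0|<-] := ltgtP 0 z; first exact: is_derive_flat_pos.
  rewrite !flat_le0 ?(ltW z0)// mulr0 addr0.
  apply: (@near_eq_is_derive _ _ _ (cst 0)).
  near=> y; have y0 : y < 0 by near: y; exact: lt_nbhsl.
  by rewrite flat_le0// ltW.
rewrite !flat_le0// mulr0 addr0.
(* At the origin the difference quotient is O(|h|) by the quadratic bound. *)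
have H : (fun h : R => h^-1 *: ((flat k \o shift 0) (h *: (1 : R)) - flat k 0)) @ 0^' --> (0 : R).
  have [C HC] := flat_le k.
  have C0 : 0 <= C by have := HC 1; rewrite expr1n mulr1; apply: le_trans; exact: flat_ge0.
  apply/cvgrPdist_le => e e0; near=> h.
  rewrite sub0r normrN /= addr0 (_ : h *: (1 : R) = h); last exact: mulr1.
  rewrite [flat k 0]flat_le0// subr0.
  rewrite /GRing.scale/= normrM normrV ?unitfE; last by near: h; exact: nbhs_dnbhs_neq.
  have h0 : 0 < `|h| by rewrite normr_gt0; near: h; exact: nbhs_dnbhs_neq.
  rewrite mulrC ler_pdivrMr// ger0_norm ?flat_ge0//.
  apply: (le_trans (HC h)); rewrite -real_normK ?num_real// expr2 mulrA.
  rewrite ler_wpM2r// (@le_trans _ _ ((C + 1) * `|h|))//.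
    by rewrite ler_wpM2r// lerDl.
  rewrite mulrC -ler_pdivlMr ?ltr_wpDl//.
  near: h; apply: dnbhs0_le; by rewrite divr_gt0// ltr_wpDl.
by apply: DeriveDef; [apply/cvg_ex; exists 0|exact: cvg_lim H].
Unshelve. all: by end_near. Qed.

Lemma smooth_flat_coord p k (a b : R) (i : 'I_p) :
  smooth (fun x : 'rV[R]_p => flat k (a * x ord0 i + b) : R^o).
Proof.
apply: (@smooth_affine_coord _ _ _ flat
  (fun k => [:: (- k%:R, k.+1); (1, k.+2)]) a b i k) => l z.
rewrite !big_cons big_nil /= addr0 mul1r; exact: is_derive_flat.
Qed.

Definition step (z : R) : R := flat 0 z / (flat 0 z + flat 0 (1 - z)).

Lemma step_den_gt0 z : 0 < flat 0 z + flat 0 (1 - z).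
Proof.
have [z0|z0] := leP z 0; last by rewrite ltr_pwDl ?flat_ge0 ?flat_gt0.
by rewrite ltr_wpDl ?flat_ge0// flat_gt0// subr_gt0 (le_lt_trans z0).
Qed.

Lemma step_le0 z : z <= 0 -> step z = 0.
Proof. by move=> z0; rewrite /step flat_le0// mul0r. Qed.

Lemma step_ge1 z : 1 <= z -> step z = 1.
Proof.
move=> z1; rewrite /step [flat 0 (1 - z)]flat_le0 ?subr_le0// addr0 divff//.
by rewrite gt_eqF// flat_gt0// (lt_le_trans _ z1).
Qed.

Lemma step_ge0 z : 0 <= step z.
Proof. by rewrite divr_ge0 ?flat_ge0// ltW// step_den_gt0. Qed.

Lemma step_le1 z : step z <= 1.
Proof. by rewrite ler_pdivrMr ?step_den_gt0// mul1r lerDl flat_ge0. Qed.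

Lemma smooth_step_coord p (a b : R) (i : 'I_p) :
  smooth (fun x : 'rV[R]_p => step (a * x ord0 i + b) : R^o).
Proof.
have E (x : 'rV[R]_p) : 1 - (a * x ord0 i + b) = - a * x ord0 i + (1 - b) by ring.
rewrite /step; under eq_fun do rewrite E.
apply: smoothM; first exact: smooth_flat_coord.
apply: smoothV => [x|]; first by rewrite -E gt_eqF// step_den_gt0.
by apply: smoothD; exact: smooth_flat_coord.
Qed.

(** Consecutive translates of [step] are subtracted so that sums telescope: a partition of unity
    with no normalising factor. *)
Definition unitbump (j : nat) (z : R) : R := step (z - j%:R) - step (z - j.+1%:R).

Lemma unitbump_ge0 j z : 0 <= unitbump j z.
Proof.
rewrite subr_ge0; have [h|h] := leP 1 (z - j%:R); first by rewrite (step_ge1 h) step_le1.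
by rewrite [step (z - j.+1%:R)]step_le0 ?step_ge0// -natr1; lra.
Qed.

Lemma unitbump_supp j z : unitbump j z != 0 -> j%:R <= z <= j%:R + 2.
Proof.
apply: contraR; rewrite negb_and -!ltNge => /orP[] h; rewrite /unitbump -natr1.
  by rewrite !step_le0 ?subrr//; lra.
by rewrite !step_ge1 ?subrr//; lra.
Qed.

Lemma sum_unitbump N z : 1 <= z <= N%:R -> \sum_(j < N) unitbump j z = 1.
Proof.
move=> /andP[z1 zN].
rewrite -(big_mkord xpredT (fun j => unitbump j z)).
rewrite (eq_bigr (fun j => (- step (z - j.+1%:R)) - (- step (z - j%:R)))); last first.
  by move=> j _; rewrite /unitbump opprK addrC.
rewrite telescope_sumr// opprK subr0 [step z]step_ge1//.
by rewrite [step (z - N%:R)]step_le0 ?subr_le0 ?subr0 ?oppr0 ?add0r // ; lra.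
Qed.

Lemma smooth_unitbump_coord p j (a b : R) (i : 'I_p) :
  smooth (fun x : 'rV[R]_p => unitbump j (a * x ord0 i + b) : R^o).
Proof.
rewrite /unitbump; under eq_fun do rewrite -!addrA -[- step _]mulN1r.
apply: smoothD; first exact: smooth_step_coord.
by apply: (@smoothZ _ _ R^o); exact: smooth_step_coord.
Qed.

End SmoothStep.

(** * Smooth approximation on the cube *)

Section Cube.
Context {R : realType}.

Lemma rV_coord_le_norm p (x : 'rV[R]_p) i : `|x ord0 i| <= `|x|.
Proof.
by rewrite [leRHS]/Num.Def.normr/= mx_normrE; exact: (le_bigmax _ _ (ord0, i)).
Qed.

Lemma rV_norm_le p (x : 'rV[R]_p) c :
  0 <= c -> (forall i, `|x ord0 i| <= c) -> `|x| <= c.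
Proof.
move=> c0 h; rewrite [leLHS]/Num.Def.normr/= mx_normrE.
by rewrite (bigmax_le _ c0)// => -[i j] _ /=; rewrite (ord1 i).
Qed.

Lemma compact_cube m : compact (cube m : set 'rV[R]_m).
Proof.
rewrite (_ : cube m = [set v : 'rV[R]_m | forall i, `[-1, 1]%classic (v ord0 i)]).
  by apply: (@rV_compact _ _ (fun=> `[(-1 : R), 1]%classic)) => i; exact: segment_compact.
by apply/seteqP; split => x h i; have := h i; rewrite /= in_itv.
Qed.

(** Compactness is used as a covering property along the filter of scales tending to 0 from the
    right; monotonicity lets each local radius serve for all smaller scales. *)
Lemma compact_lebesgue_number (V : normedModType R) (K : set V) (Q : R -> V -> Prop) :
  compact K ->
  (forall d d' x, d' <= d -> Q d x -> Q d' x) ->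
  (forall x, K x -> exists2 r : R, 0 < r &
     forall x', `|x' - x| < r -> K x' -> Q r x') ->
  exists2 d : R, 0 < d & forall x, K x -> Q d x.
Proof.
move=> /compact_near_coveringP /near_covering_withinP cK mono loc.
have h : \forall d \near 0^'+, K `<=` Q d.
  apply: cK => x /loc[r r0 Qr].
  exists ([set x' | `|x' - x| < r], [set d | d < r]); last first.
    by move=> [x' d] [/= x'r dr] Kx'; apply: mono (Qr _ x'r Kx'); exact: ltW.
  split => /=; last exact: nbhs_right_lt.
  by apply/nbhs_ballP; exists r => //= y; rewrite -ball_normE/= distrC.
near (0 : R)^'+ => d; exists d; first by near: d; exact: nbhs_right_gt.
by move=> x; apply: (near h d).
Unshelve. all: by end_near. Qed.

Lemma smooth_bounded_cube m (f : 'rV[R]_m -> R^o) : smooth f ->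
  exists2 C : R, 0 <= C & forall x, cube m x -> `|f x| <= C.
Proof.
move=> sf; have cf : {within cube m, continuous f}.
  by apply: continuous_subspaceT; exact: smooth_continuous.
have [M [_ hM]] := compact_bounded (continuous_compact cf (@compact_cube m)).
exists (Num.max 0 (M + 1)); first by rewrite le_max lexx.
by move=> x Kx; rewrite le_max; apply/orP; right; apply: hM; [rewrite ltrDl|exists x].
Qed.

Lemma near_cube_interior m (x : 'rV[R]_m) : (forall i, `|x ord0 i| < 1) ->
  exists2 r : R, 0 < r & forall y : 'rV[R]_m, `|y - x| < r ->
    forall i, `|y ord0 i| <= 1 - r.
Proof.
move=> hx.
(* If 2r <= 1 - |x_i| and |y_i - x_i| < r, then |y_i| <= 1 - r. *)
have h : \forall r \near (0 : R)^'+, forall i, r <= (1 - `|x ord0 i|) / 2.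
  by apply: filter_forall => i; apply: nbhs_right_le; rewrite divr_gt0// subr_gt0.
near (0 : R)^'+ => r; exists r; first by near: r; exact: nbhs_right_gt.
move=> y yx i.
have hr : r <= (1 - `|x ord0 i|) / 2 by apply: (near h r).
have h1 : `|y ord0 i - x ord0 i| <= `|y - x|.
  by have := rV_coord_le_norm (y - x) i; rewrite !mxE.
have h2 : `|y ord0 i| <= `|y ord0 i - x ord0 i| + `|x ord0 i|.
  by rewrite -{1}(subrK (x ord0 i) (y ord0 i)) ler_normD.
lra.
Unshelve. all: by end_near. Qed.

Lemma cubeP m (x : 'rV[R]_m) : cube m x <-> forall i, `|x ord0 i| <= 1.
Proof. by split => h i; have := h i; rewrite ler_norml. Qed.

(* Off the cube the function is extended by zero; the vanishing near the
   boundary makes the extension continuous. *)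
Lemma cube_uniform_modulus m (s : 'rV[R]_m -> R) (U : set 'rV[R]_m) (e : R) :
  {within cube m, continuous s} -> open U -> cube_bdry m `<=` U ->
  (forall x, U x -> cube m x -> s x = 0) -> 0 < e ->
  let s0 := patch (fun=> 0) (cube m) s in
  exists2 d : R, 0 < d & forall x, cube m x ->
    (forall y, `|y - x| <= d -> `|s0 y - s0 x| <= e) /\
    (s0 x != 0 -> forall i, `|x ord0 i| <= 1 - d).
Proof.
move=> cs oU bU sU e0 s0.
have s0in x : cube m x -> s0 x = s x by move=> Kx; rewrite /s0 patchT// inE.
have s0out x : ~ cube m x -> s0 x = 0 by move=> Kx; rewrite /s0 patchC// inE.
have s0U x : U x -> s0 x = 0.
  by move=> Ux; have [Kx|Kx] := pselect (cube m x); [rewrite s0in// sU|rewrite s0out].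
apply: (@compact_lebesgue_number _ (cube m)
  (fun d x => (forall y, `|y - x| <= d -> `|s0 y - s0 x| <= e) /\
    (s0 x != 0 -> forall i, `|x ord0 i| <= 1 - d))).
- exact: compact_cube.
- move=> d d' x dd' [h1 h2]; split=> [y yx|/h2 h i].
    by apply: h1; exact: le_trans dd'.
  by apply: le_trans (h i) _; rewrite lerD2l lerN2.
move=> x Kx.
(* A radius [r] at [x] with tolerance [e / 2] gives radius [r / 2] with tolerance [e] at every
   centre within [r / 2], by the triangle inequality through [x]. *)
suff [r r0 hr] : exists2 r : R, 0 < r & forall x', `|x' - x| < r ->
    `|s0 x' - s0 x| <= e / 2 /\ (s0 x' != 0 -> forall i, `|x' ord0 i| <= 1 - r).
  exists (r / 2); first by rewrite divr_gt0.
  move=> x' x'r Kx'; have x'r2 : `|x' - x| < r by lra.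
  have [h1 h2] := hr _ x'r2; split=> [y yx'|/h2 h i]; last first.
    by apply: le_trans (h i) _; lra.
  have yx : `|y - x| < r.
    have -> : y - x = (y - x') + (x' - x) by rewrite addrA subrK.
    by apply: (le_lt_trans (ler_normD _ _)); lra.
  have [h3 _] := hr _ yx.
  have -> : s0 y - s0 x' = (s0 y - s0 x) - (s0 x' - s0 x) by ring.
  by apply: (le_trans (ler_normB _ _)); lra.
(* Near a boundary point [s0] vanishes; around an interior point a small ball stays inside the cube,
   where [s] is continuous. *)
have [bx|nbx] := pselect (cube_bdry m x).
  have /nbhs_ballP[r /= r0 hr] : nbhs x U by apply: open_nbhs_nbhs; split => //; exact: bU.
  exists r => // x' x'r.
  have Ux' : U x' by apply: hr; rewrite -ball_normE/= distrC.
  by rewrite (s0U _ Ux') (s0U _ (bU _ bx)) subrr normr0 divr_ge0 ?ltW// eqxx.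
have hx i : `|x ord0 i| < 1.
  have /cubeP/(_ i) := Kx; rewrite le_eqVlt => /orP[/eqP h|//].
  by exfalso; apply: nbx; split => //; exists i.
have [r1 r10 hr1] := near_cube_interior hx.
have /subspace_continuousP /(_ x Kx) /cvgrPdist_le /(_ (e / 2)) := cs.
rewrite divr_gt0// => /(_ isT) /nbhs_ballP[r2 /= r20 hr2].
exists (Num.min r1 r2); first by rewrite lt_min r10.
move=> x'; rewrite lt_min => /andP[x'r1 x'r2].
have h i : `|x' ord0 i| <= 1 - Num.min r1 r2.
  by apply: le_trans (hr1 _ x'r1 i) _; rewrite lerD2l lerN2 ge_min lexx.
split=> //; have Kx' : cube m x'.
  by apply/cubeP => i; apply: le_trans (hr1 _ x'r1 i) _; lra.
rewrite !s0in// distrC; apply: hr2 => //.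
by rewrite -ball_normE/= distrC.
Qed.

(** [S] averages grid samples of the zero extension of [s] by a product partition of unity whose
    bumps reach at most [d / 2]. Nonzero samples lie at depth [d] inside the cube, so [S] vanishes
    within [d / 2] of the boundary and beyond. *)
Lemma smooth_approx m (s : 'rV[R]_m -> R) (U : set 'rV[R]_m) (e : R) :
  {within cube m, continuous s} -> open U -> cube_bdry m `<=` U ->
  (forall x, U x -> cube m x -> s x = 0) -> 0 < e ->
  exists S : 'rV[R]_m -> R^o, smooth S /\
    (forall x, cube m x -> `|S x - s x| <= e) /\
    exists2 eta : R, 0 < eta &
      forall x : 'rV[R]_m, (exists i, 1 - eta < `|x ord0 i|) -> S x = 0.
Proof.
move=> cs oU bU sU e0.
have /= := cube_uniform_modulus cs oU bU sU e0.
set s0 := patch _ _ _ => -[d d0 hd].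
have [M M0 hM] : exists2 M : nat, (0 < M)%N & 2 / M%:R <= d / 2.
  exists (Num.trunc (4 / d)).+1 => //.
  rewrite ler_pdivrMr ?ltr0n// mulrC mulrA ler_pdivlMr//.
  have := @truncnS_gt R (4 / d); rewrite ltr_pdivrMr// => h; lra.
have M0' : 0 < M%:R :> R by rewrite ltr0n.
(* On the cube the rescaled coordinate M x_i + 2M lies in [M, 3M], inside the range [1, N] where the
   bumps sum to 1. *)
pose N := (3 * M)%N.
pose pt (f : {ffun 'I_m -> 'I_N}) : 'rV[R]_m := \row_i ((f i)%:R / M%:R - 2 : R).
pose w (f : {ffun 'I_m -> 'I_N}) (x : 'rV[R]_m) : R^o :=
  \prod_(i < m) unitbump (f i) (M%:R * x ord0 i + 2 * M%:R : R).
have w_near f x : w f x != 0 -> forall i, `|pt f ord0 i - x ord0 i| <= d / 2.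
  move=> /prodf_neq0 h i; have /unitbump_supp := h i isT.
  set c := x ord0 i; move=> /andP[h1 h2]; apply: le_trans hM.
  rewrite !mxE -/c ler_norml.
  have E : (f i)%:R = ((f i)%:R / M%:R) * M%:R :> R by rewrite divfK// gt_eqF.
  have E2 : 2 = (2 / M%:R) * M%:R :> R by rewrite divfK// gt_eqF.
  set a := (f i)%:R / M%:R in E *; set b := 2 / M%:R in E2 *.
  have k1 : (a - 2 - c) * M%:R <= 0 by rewrite E in h1; lra.
  have k2 : 0 <= (a - 2 - c + b) * M%:R by rewrite E in h2; lra.
  rewrite pmulr_lle0// in k1; rewrite pmulr_lge0// in k2.
  have b0 : 0 < b by rewrite divr_gt0.
  by apply/andP; split; lra.
pose S (x : 'rV[R]_m) : R^o := \sum_f s0 (pt f) * w f x.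
exists S; split.
  apply: smooth_sum => f; apply: smoothM; first exact: smooth_cst.
  by apply: smooth_prod => i; exact: smooth_unitbump_coord.
split=> [x Kx|]; last first.
  exists (d / 2); first by rewrite divr_gt0.
  move=> x [i hi]; rewrite /S big1// => f _.
  have [->|sf] := eqVneq (s0 (pt f)) 0; first by rewrite mul0r.
  have [->|wf] := eqVneq (w f x) 0; first by rewrite mulr0.
  exfalso; have Kf : cube m (pt f).
    by apply: contrapT => K; move: sf; rewrite /s0 patchC ?inE// eqxx.
  have [_ /(_ sf i) h1] := hd _ Kf.
  have h2 := w_near _ _ wf i.
  have h3 : `|x ord0 i| <= `|pt f ord0 i| + `|pt f ord0 i - x ord0 i|.
    by rewrite -{1}(subKr (pt f ord0 i) (x ord0 i)) ler_normB.
  lra.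
(* By distributivity the sum over grid points is the product over coordinates of one-dimensional
   sums. *)
have sw : \sum_f w f x = 1.
  rewrite /w -(bigA_distr_bigA (fun i (j : 'I_N) => unitbump j (M%:R * x ord0 i + 2 * M%:R))) /=.
  rewrite big1// => i _; apply: sum_unitbump.
  have /andP[h1 h2] := Kx i; have M1 : 1 <= M%:R :> R by rewrite ler1n.
  rewrite /N natrM.
  have k1 : 0 <= (x ord0 i + 1) * M%:R by rewrite mulr_ge0// ?ler0n//; lra.
  have k2 : 0 <= (1 - x ord0 i) * M%:R by rewrite mulr_ge0// ?ler0n//; lra.
  by apply/andP; split; lra.
have -> : s x = s0 x by rewrite /s0 patchT// inE.
rewrite -[s0 x]mulr1 -sw mulr_sumr -sumrB.
rewrite (le_trans (ler_norm_sum _ _ _))//.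
rewrite -[leRHS]mulr1 -sw mulr_sumr; apply: ler_sum => f _.
have w0 : 0 <= w f x by apply: prodr_ge0 => i _; exact: unitbump_ge0.
rewrite -mulrBl normrM [X in _ * X]ger0_norm//.
have [->|wf] := eqVneq (w f x) 0; first by rewrite !mulr0.
apply: ler_wpM2r => //; have [h _] := hd _ Kx; apply: h.
apply: rV_norm_le => [|i]; first exact: ltW.
rewrite !mxE; have := w_near _ _ wf i; rewrite mxE => /le_trans; apply; lra.
Qed.

End Cube.

(** * Fast oscillations *)

Section Oscillation.
Context {R : realType} {p : nat}.
Context (i0 : 'I_p) (kp : R).
Implicit Types (S : 'rV[R]_p -> R^o) (l q : R) (e : nat).

(** [kp] multiplies the frequency, [q] is the phase, and [e] counts the powers of [l] left to pay
    for derivatives in the direction [i0]. *)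
Definition osc l e S q : 'rV[R]_p -> R^o :=
  fun x => (l ^+ e : R) *: (S x * cos (kp / l * x ord0 i0 + q) : R^o).

Lemma smooth_osc l e S q : smooth S -> smooth (osc l e S q).
Proof.
move=> sS; apply: (@smoothZ _ _ R^o); apply: smoothM => //.
exact: smooth_cos_coord.
Qed.

(** A derivative falling on the cosine produces [kp / l], which consumes one factor of [l ^+ e];
    positivity of [e] in the fast direction keeps [e.-1] from truncating. *)
Lemma pder_osc l e S q i : smooth S -> l != 0 -> (i = i0 -> 0 < e)%N ->
  pder i (osc l e S q) = fun x => osc l e (pder i S) q x +
    (kp * (i0 == i)%:R : R) *: osc l e.-1 S (q + pi / 2) x.
Proof.
move=> sS l0 e0; rewrite /osc pderZ; last first.
  by move=> x; apply: smooth_diff; apply: smoothM => //; exact: smooth_cos_coord.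
apply/funext => x; rewrite pderM; last 2 first.
  by move=> y; exact: smooth_diff.
  by move=> y; apply: smooth_diff; exact: smooth_cos_coord.
rewrite pder_cos_coord scalerDr addrC; congr (_ + _).
rewrite /GRing.scale /=; case: eqVneq => [E|_]; last by rewrite !mulr0 !mul0r !mulr0.
have := e0 (esym E); case: e {e0} => // e _.
by rewrite exprS /= !mulr1; field.
Qed.

Lemma osc_bound l e S q x (C : R) : 0 < l -> `|S x| <= C ->
  `|osc l e S q x| <= C * l ^+ e.
Proof.
move=> l0 hS; rewrite /osc /GRing.scale /= !normrM mulrC.
rewrite [`|l ^+ e|]ger0_norm ?exprn_ge0 ?(ltW l0)//.
apply: ler_wpM2r; first by rewrite exprn_ge0 ?ltW.
rewrite -[leRHS]mulr1; apply: ler_pM => //.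
by rewrite ler_norml cos_geN1 cos_le1.
Qed.

(* Each derivative in the fast direction costs one power of [l], all the
   others are free. *)
Lemma iter_pder_osc_le N S q e : smooth S ->
  exists2 C : R, 0 <= C & forall l s x, 0 < l -> l <= 1 -> (size s <= N)%N ->
    (count_mem i0 s <= e)%N -> cube p x ->
    `|iter_pder s (osc l e S q) x| <= C * l ^+ (e - count_mem i0 s).
Proof.
elim: N S q e => [|N IH] S q e sS.
  have [C C0 hC] := smooth_bounded_cube sS; exists C => // l [|//] x l0 _ _ _ Kx.
  by rewrite subn0; apply: osc_bound => //; exact: hC.
have [C0 C00 hC0] := IH S q e sS.
have /choice[C1 hC1] : forall i, exists C, 0 <= C /\
    forall l s x, 0 < l -> l <= 1 -> (size s <= N)%N ->
    (count_mem i0 s <= e)%N -> cube p x ->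
    `|iter_pder s (osc l e (pder i S) q) x| <= C * l ^+ (e - count_mem i0 s).
  by move=> i; have [C ? ?] := IH (pder i S) q e (smooth_pder i sS); exists C.
have [C2 C20 hC2] := IH S (q + pi / 2) e.-1 sS.
have s1 : 0 <= \sum_i C1 i by apply: sumr_ge0 => i _; have [] := hC1 i.
exists (C0 + \sum_i C1 i + `|kp| * C2).
  by rewrite !addr_ge0// mulr_ge0.
move=> l s x l0 l1 hs hc Kx.
have lX k : 0 <= l ^+ k by rewrite exprn_ge0// ltW.
case: (leqP (size s) N) => hsN.
  apply: le_trans (hC0 l s x l0 l1 hsN hc Kx) _.
  apply: ler_wpM2r => //; rewrite -addrA lerDl addr_ge0// mulr_ge0//.
(* The derivative applied first, in direction [i], is expanded by [pder_osc]; the induction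
   hypothesis bounds the remaining derivatives of both terms. *)
case/lastP: s hs hc hsN => // s i; rewrite size_rcons ltnS => hs.
rewrite -cats1 count_cat /= addn0 => hc _.
rewrite cats1 iter_pder_rcons pder_osc//; last 2 first.
- by rewrite gt_eqF.
- by move=> E; rewrite E eqxx addn1 in hc; exact: leq_ltn_trans hc.
rewrite iter_pderD; last 2 first.
- by apply: smooth_osc; exact: smooth_pder.
- exact: (@smoothZ _ _ R^o _ _ (smooth_osc l e.-1 (q + pi / 2) sS)).
rewrite (iter_pderZ s (kp * _) (smooth_osc l e.-1 (q + pi / 2) sS)).
apply: (le_trans (ler_normD _ _)).
have hci : (count_mem i0 s <= e)%N by apply: leq_trans hc; exact: leq_addr.
have C1i : C1 i <= \sum_i C1 i.
  rewrite (bigD1 i)//= lerDl sumr_ge0// => j _; by have [] := hC1 j.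
have [C1i0 /(_ l s x l0 l1 hs hci Kx) h1] := hC1 i.
rewrite normrZ normrM.
case: (eqVneq i0 i) hc => [E|ne] hc; last first.
  rewrite /= normr0 mulr0 mul0r addr0 addn0.
  apply: le_trans h1 _; apply: ler_wpM2r => //.
  by rewrite -addrA addrCA (le_trans C1i)// lerDl addr_ge0// mulr_ge0.
rewrite /= normr1 mulr1; rewrite /= addn1 in hc.
have hc' : (count_mem i0 s <= e.-1)%N by case: (e) hc.
have h2 := hC2 l s x l0 l1 hs hc' Kx.
have ee : (e.-1 - count_mem i0 s = e - (count_mem i0 s + 1))%N.
  by rewrite -subn1 subnAC subnDA.
rewrite ee in h2; set X := l ^+ (e - (count_mem i0 s + 1)) in h2 *.
have hX : l ^+ (e - count_mem i0 s) <= X.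
  by apply: ler_wiXn2l; rewrite ?(ltW l0)// subnDA leq_subr.
have h3 : C1 i * l ^+ (e - count_mem i0 s) <= (\sum_i C1 i) * X.
  by apply: ler_pM.
have h4 : `|kp| * `|iter_pder s (osc l e.-1 S (q + pi / 2)) x| <= `|kp| * (C2 * X).
  by apply: ler_wpM2l.
have h5 : 0 <= C0 * X by rewrite mulr_ge0// /X.
rewrite [leRHS]mulrDl [(C0 + _) * X]mulrDl; lra.
Qed.

(** The leading term arises when all [P] derivatives fall on the cosine; a derivative falling on [S]
    leaves one power of [l] unspent. *)
Lemma iter_pder_osc_lead P S q e : smooth S -> (P <= e)%N ->
  exists2 C : R, 0 <= C & forall l x, 0 < l -> l <= 1 -> cube p x ->
    `|iter_pder (nseq P i0) (osc l e S q) x -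
      kp ^+ P * osc l (e - P) S (q + (pi / 2) *+ P) x| <= C * l ^+ (e - P).+1.
Proof.
elim: P S q e => [|P IH] S q e sS hP.
  exists 0 => // l x _ _ _; rewrite mulr0n addr0 expr0 mul1r subn0 subrr normr0 mul0r.
  by [].
case: e hP => // e; rewrite ltnS => hP.
have [C1 C10 h1] := iter_pder_osc_le P q e.+1 (smooth_pder i0 sS).
have [C2 C20 h2] := IH S (q + pi / 2) e sS hP.
exists (C1 + `|kp| * C2); first by rewrite addr_ge0// mulr_ge0.
move=> l x l0 l1 Kx.
have -> : nseq P.+1 i0 = rcons (nseq P i0) i0.
  by rewrite -addn1 nseqD cats1.
rewrite iter_pder_rcons pder_osc//; last by rewrite gt_eqF.
rewrite iter_pderD; last 2 first.
- by apply: smooth_osc; exact: smooth_pder.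
- exact: (@smoothZ _ _ R^o _ _ (smooth_osc l e (q + pi / 2) sS)).
rewrite (iter_pderZ _ (kp * _) (smooth_osc l e (q + pi / 2) sS)).
rewrite eqxx mulr1 /= subSS.
have {}h1 := h1 l (nseq P i0) x l0 l1.
rewrite size_nseq count_nseq /= eqxx mul1n in h1.
have {}h1 := h1 (leqnn _) (leqW hP) Kx.
have {}h2 := h2 l x l0 l1 Kx.
rewrite -addrA -mulrS subSn// in h1 h2 *.
rewrite -addrA exprS -mulrA [X in `|_ + X|](_ : _ = kp *
  (iter_pder (nseq P i0) (osc l e S (q + pi / 2)) x -
   kp ^+ P * osc l (e - P) S (q + (pi / 2) *+ P.+1) x)); last first.
  by rewrite mulrBr.
apply: (le_trans (ler_normD _ _)); rewrite [leRHS]mulrDl lerD// normrM -mulrA.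
exact: ler_wpM2l.
Qed.

(** The initial phase is cancelled by [r] shifts of pi/2, leaving a plain cosine. Any other sequence
    of length at most [r] contains [i0] fewer than [r] times, so a factor [l] survives. *)
Lemma osc_estimate r S : smooth S ->
  exists2 C : R, 0 <= C & forall l x, 0 < l -> l <= 1 -> cube p x ->
    (forall s, (size s <= r)%N -> s <> nseq r i0 ->
      `|iter_pder s (osc l r S (- ((pi / 2) *+ r))) x| <= C * l) /\
    `|iter_pder (nseq r i0) (osc l r S (- ((pi / 2) *+ r))) x -
      kp ^+ r * S x * cos (kp / l * x ord0 i0)| <= C * l.
Proof.
move=> sS; set q := - _.
have [C1 C10 h1] := iter_pder_osc_le r q r sS.
have [C2 C20 h2] := iter_pder_osc_lead q sS (leqnn r).
exists (C1 + C2); first by rewrite addr_ge0.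
move=> l x l0 l1 Kx; split => [s hs sr|]; last first.
  have := h2 l x l0 l1 Kx; rewrite subnn expr1 /osc expr0 /q addNr addr0 scale1r mulrA.
  by move=> /le_trans; apply; rewrite mulrDl lerDr mulr_ge0// ltW.
have hc : (count_mem i0 s < r)%N.
  rewrite ltn_neqAle (leq_trans (count_size _ _) hs) andbT; apply/eqP => hc.
  have hsr : size s = r by apply/eqP; rewrite eqn_leq hs -hc count_size.
  apply: sr; rewrite -hsr; apply/all_pred1P.
  by rewrite all_count hc hsr.
apply: le_trans (h1 l s x l0 l1 hs (ltnW hc) Kx) _; apply: ler_pM => //.
- by rewrite exprn_ge0// ltW.
- by rewrite lerDl.
- rewrite -[leRHS]expr1; apply: ler_wiXn2l; rewrite ?(ltW l0)// subn_gt0//.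
Qed.

End Oscillation.

(** * Multi-indices as sequences of directions *)

Section MultiIndex.
Context {R : realType} {m : nat}.

Definition mindex_seq (a : 'I_m -> nat) := flatten [seq nseq (a i) i | i <- enum 'I_m].

Lemma count_mindex_seq a j : count_mem j (mindex_seq a) = a j.
Proof.
rewrite count_flatten -map_comp sumnE big_map big_enum (bigD1 j)//= count_nseq /= eqxx mul1n.
rewrite big1 ?addn0// => i ij; by rewrite count_nseq /= (negbTE ij).
Qed.

Lemma size_mindex_seq a : size (mindex_seq a) = mdeg a.
Proof.
rewrite size_flatten /shape -map_comp sumnE big_map big_enum /mdeg.
by apply: eq_bigr => i _ /=; rewrite size_nseq.
Qed.

End MultiIndex.

Lemma perp_index_seq m r (a : 'I_m.+1 -> nat) : perp_index r a ->
  mindex_seq a <> nseq r ord0.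
Proof.
move=> [_ [i hi]] E; apply: hi; rewrite -(count_mindex_seq a i) E count_nseq /=.
by rewrite -val_eqE /= eq_sym; case: eqP; rewrite ?mul1n ?mul0n.
Qed.

Lemma not_perp_index_seq m r (a : 'I_m.+1 -> nat) : (mdeg a <= r)%N ->
  ~ perp_index r a -> a = (fun i => if val i == 0%N then r else 0%N) /\
  mindex_seq a = nseq r ord0.
Proof.
move=> ha na.
have E : a = (fun i => if val i == 0%N then r else 0%N).
  by apply/funext => i; apply: contrapT => h; apply: na; split => //; exists i.
split => //.
have sz : size (mindex_seq a) = r.
  apply/eqP; rewrite eqn_leq size_mindex_seq ha /mdeg (bigD1 ord0)//=.
  by rewrite {1}E /= leq_addr.
rewrite -sz; apply/all_pred1P; rewrite all_count sz count_mindex_seq E.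
by rewrite /= eqxx.
Qed.

(** * Shears of the cube *)

Section Shear.
Context {R : realType} {m : nat}.
Context (g : 'rV[R]_m -> R^o) (y : 'I_m) (sg : smooth g).
Let e : 'rV[R]_m := evec y.

Definition shear (t : R) (x : 'rV[R]_m) : 'rV[R]_m := x + (t * g x) *: evec y.

Lemma shear_coord t x i : i != y -> shear t x ord0 i = x ord0 i.
Proof. by move=> iy; rewrite !mxE eqxx (negbTE iy) mulr0 addr0. Qed.

Lemma shear_coord_dir t x : shear t x ord0 y = x ord0 y + t * g x.
Proof. by rewrite !mxE !eqxx mulr1. Qed.

Lemma derive_shear t x v : 'D_v (shear t) x = v + (t * 'd g x v) *: evec y.
Proof.
have dg : differentiable g x by exact: smooth_diff.
have dtg : differentiable (fun z => t * g z : R^o) x by exact: differentiableZ.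
rewrite /shear (@deriveD _ _ _ id (fun z => (t * g z) *: evec y)).
- rewrite derive_id; congr (_ + _).
  rewrite deriveE; last exact: differentiableZl.
  rewrite diffZl//; congr (_ *: _).
  transitivity ('D_v (fun z => t * g z : R^o) x); first exact/esym/deriveE.
  transitivity (t *: 'D_v g x : R^o).
    exact (@deriveZ _ _ R^o g t _ _ (diff_derivable dg)).
  by congr (_ * _); exact: deriveE.
- exact: derivable_id.
- by apply: diff_derivable; exact: differentiableZl.
Qed.

Lemma is_derive_line (x : 'rV[R]_m) (a : R) :
  is_derive a 1 (fun b : R => g (b *: e + x) : R^o) (pder y g (a *: e + x)).
Proof.
have E : (fun h : R => h^-1 *: (((fun b : R => g (b *: e + x) : R^o) \o shift a)
       (h *: (1 : R)) - g (a *: e + x))) =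
   (fun h : R => h^-1 *: ((g \o shift (a *: e + x)) (h *: e) - g (a *: e + x))).
  apply/funext => h /=; congr (_ *: (g _ - _)).
  by rewrite (_ : h *: (1 : R) = h) ?scalerDl ?addrA//; exact: mulr1.
have d : derivable g (a *: e + x) e by exact/diff_derivable/smooth_diff.
apply: DeriveDef; first by rewrite /derivable E; exact: d.
by rewrite /derive E.
Qed.

Lemma continuous_line (x : 'rV[R]_m) : continuous (fun b : R => g (b *: e + x) : R).
Proof.
move=> a; apply/differentiable_continuous/derivable1_diffP.
by have [] := is_derive_line x a.
Qed.

Context (gbd : forall x, cube m x -> `|x ord0 y| = 1 -> g x = 0).
Context (dg_small : forall x, cube m x -> `|pder y g x| <= 1 / 2).

Lemma line_coord (x : 'rV[R]_m) a i : (a *: e + x) ord0 i = a * (i == y)%:R + x ord0 i.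
Proof. by rewrite !mxE eqxx. Qed.

Lemma line_cube (x : 'rV[R]_m) a : cube m x -> -1 <= a + x ord0 y <= 1 ->
  cube m (a *: e + x).
Proof.
move=> Kx h i; rewrite line_coord; case: eqP => [->|_]; rewrite ?mulr1// mulr0 add0r.
exact: Kx.
Qed.

Lemma line_lipschitz x a b : a <= b -> cube m x -> -1 <= a + x ord0 y ->
  b + x ord0 y <= 1 -> `|g (b *: e + x) - g (a *: e + x)| <= (b - a) / 2.
Proof.
move=> ab Kx ha hb.
have [|c cab ->] := MVT_segment ab (fun z _ => is_derive_line x z).
  by apply: continuous_subspaceT; exact: continuous_line.
move: cab; rewrite in_itv /= => /andP[ac cb].
rewrite normrM mulrC [`|b - a|]ger0_norm ?subr_ge0//.
apply: ler_wpM2l; first by rewrite subr_ge0.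
by rewrite -[2^-1]mul1r dg_small//; apply: line_cube => //; apply/andP; split; lra.
Qed.

Lemma line_lipschitz_norm x c : cube m x -> cube m (c *: e + x) ->
  `|g (c *: e + x) - g x| <= `|c| / 2.
Proof.
move=> Kx Kx'; have := Kx' y; rewrite line_coord eqxx mulr1 => /andP[h1 h2].
have /andP[h3 h4] := Kx y.
have E : x = 0 *: e + x by rewrite scale0r add0r.
have [c0|c0] := leP 0 c.
  have := @line_lipschitz x 0 c c0 Kx; rewrite -E subr0 [`|c|]ger0_norm// => h.
  by apply: h; lra.
have := @line_lipschitz x c 0 (ltW c0) Kx; rewrite -E sub0r [`|c|]ltr0_norm// distrC => h.
by apply: h; lra.
Qed.

(** Along a line in direction [y] the function [g] is 1/2-Lipschitz and vanishes at both end faces,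
    so a point moves by at most half its distance to either face. *)
Lemma shear_cube t x : 0 <= t <= 1 -> cube m x -> cube m (shear t x).
Proof.
move=> /andP[t0 t1] Kx i; case: (eqVneq i y) => [->|iy]; last first.
  by rewrite shear_coord//; exact: Kx.
rewrite shear_coord_dir; set c := x ord0 y.
have /andP[c1 c2] := Kx y; rewrite -/c in c1 c2.
have K1 : cube m ((1 - c) *: e + x) by apply: line_cube => //; rewrite -/c; apply/andP; split; lra.
have K2 : cube m ((- 1 - c) *: e + x) by apply: line_cube => //; rewrite -/c; apply/andP; split; lra.
have g1 : g ((1 - c) *: e + x) = 0.
  by apply: gbd => //; rewrite line_coord eqxx mulr1 -/c subrK normr1.
have g2 : g ((- 1 - c) *: e + x) = 0.
  by apply: gbd => //; rewrite line_coord eqxx mulr1 -/c subrK normrN normr1.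
have := line_lipschitz_norm Kx K1; have := line_lipschitz_norm Kx K2.
rewrite g1 g2 !sub0r !normrN [`|1 - c|]ger0_norm ?subr_ge0//.
rewrite [`|-1 - c|]ler0_norm; last by lra.
have tg : `|t * g x| <= `|g x| by rewrite normrM ler_piMl// ger0_norm.
move: tg; rewrite ler_norml => /andP[k1 k2] k3 k4.
by apply/andP; split; lra.
Qed.

(** Two points with the same image differ by [c *: e] with |c| <= |g x' - g x| <= |c| / 2, which
    forces [c = 0]. *)
Lemma shear_inj t : 0 <= t <= 1 -> {in cube m &, injective (shear t)}.
Proof.
move=> /andP[t0 t1] x x'; rewrite !inE => Kx Kx' E.
pose c := t * g x - t * g x'.
have E' : x' = c *: e + x.
  rewrite scalerBl addrAC; apply/eqP; rewrite eq_sym subr_eq eq_sym; apply/eqP.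
  by move: E; rewrite /shear [_ *: _ + x]addrC.
have := line_lipschitz_norm Kx (eq_ind _ (cube m) Kx' _ E').
rewrite -E' => h.
have hc : `|c| <= `|g x' - g x|.
  by rewrite /c -mulrBr normrM distrC ler_piMl// ger0_norm.
have c0 : c = 0 by apply/eqP; rewrite -normr_le0; lra.
by rewrite E' c0 scale0r add0r.
Qed.

Lemma shear_surj t : 0 <= t <= 1 -> set_surj (cube m) (cube m) (shear t).
Proof.
move=> /andP[t0 t1] z Kz; set c := z ord0 y.
have /andP[c1 c2] := Kz y; rewrite -/c in c1 c2.
(* [u b] is the [y]-coordinate of the image of [b *: e + z]; it goes from -1 to 1 between the end
   faces, hence takes the value [c]. *)
pose u (b : R) : R := b + c + t * g (b *: e + z).
have cu : continuous u.
  move=> b; apply: cvgD; first by apply: cvgD; [exact: cvg_id|exact: cvg_cst].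
  by apply: cvgM; [exact: cvg_cst|exact: continuous_line].
have u1 : u (1 - c) = 1.
  rewrite /u gbd ?mulr0 ?addr0 ?subrK//.
    by apply: line_cube => //; rewrite -/c; apply/andP; split; lra.
  by rewrite line_coord eqxx mulr1 -/c subrK normr1.
have u2 : u (- 1 - c) = -1.
  rewrite /u gbd ?mulr0 ?addr0 ?subrK//.
    by apply: line_cube => //; rewrite -/c; apply/andP; split; lra.
  by rewrite line_coord eqxx mulr1 -/c subrK normrN normr1.
have [|||b + ub] := @IVT R u (- 1 - c) (1 - c) c; first by lra.
- exact: continuous_subspaceT.
- by rewrite u1 u2 ge_min le_max c1 c2 orbT.
rewrite in_itv /= => /andP[b1 b2]; exists (b *: e + z).
  by apply: line_cube => //; rewrite -/c; apply/andP; split; lra.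
rewrite /shear -/e addrAC -scalerDl (_ : b + _ = 0) ?scale0r ?add0r//.
by move: ub; rewrite /u => ub; lra.
Qed.

Lemma diff_dir_small t x : 0 <= t <= 1 -> cube m x -> `|t * 'd g x e| <= 1 / 2.
Proof.
move=> /andP[t0 t1] Kx; rewrite -deriveE; last exact: smooth_diff.
by apply: le_trans (dg_small Kx); rewrite normrM ler_piMl// ger0_norm.
Qed.

(** The contraction argument of [shear_inj], with the differential of [g] in place of its
    increments. *)
Lemma derive_shear_inj t x : 0 <= t <= 1 -> cube m x ->
  injective (fun v => 'D_v (shear t) x).
Proof.
move=> t01 Kx v v' /=; rewrite !derive_shear -/e => E.
pose c := t * 'd g x v' - t * 'd g x v.
have E' : v - v' = c *: e.
  by rewrite scalerBl; apply/eqP; rewrite subr_eq addrAC eq_sym subr_eq eq_sym addrC E.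
have E2 : c = - c * (t * 'd g x e).
  have : 'd g x (v - v') = 'd g x (c *: e) by rewrite E'.
  rewrite linearB linearZ /= /GRing.scale /= => h.
  by rewrite mulNr mulrCA -h /c mulrBr opprB.
have h := diff_dir_small t01 Kx.
have c0 : `|c| <= `|c| * (1 / 2) by rewrite {1}E2 normrM normrN ler_wpM2l.
have : c = 0 by apply/eqP; rewrite -normr_le0; lra.
by move=> c0'; apply/eqP; rewrite -subr_eq0 E' c0' scale0r.
Qed.

Lemma isotopy_shear : isotopy shear.
Proof.
split.
  (* The first coordinate of [w] is time. The space part is expanded in basis vectors so that its
     smoothness reduces to that of coordinates. *)
  exists (fun w : 'rV[R]_(1 + m) => \sum_i (w ord0 (rshift 1 i) : R) *: evec i +
    (w ord0 (lshift m ord0) * g (rsubmx w) : R) *: evec y); split.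
    apply: smoothD.
      by apply: smooth_sum => i; apply: smoothZl; exact: smooth_coord.
    by apply: smoothZl; apply: smoothM; [exact: smooth_coord|exact: smooth_rsubmx].
  move=> t x; rewrite /shear row_mxKr row_mxEl mxE; congr (_ + _).
  rewrite {1}[x]row_sum_delta; apply: eq_bigr => i _.
  by rewrite row_mxEr.
split=> [x _|t t01]; first by rewrite /shear mul0r scale0r addr0.
split; last by move=> x; exact: derive_shear_inj.
split; [|exact: shear_inj|exact: shear_surj].
by move=> x; exact: shear_cube.
Qed.

Lemma derive_shear_Vhyp t x : val y <> 0%N -> 0 <= t <= 1 -> cube m x ->
  [set 'D_v (shear t) x | v in Vhyp m] = Vhyp m.
Proof.
move=> y0 t01 Kx.
have Ve c v : Vhyp m v -> Vhyp m (v + c *: e).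
  move=> Vv i i0; rewrite !mxE (Vv i i0) add0r eqxx /=.
  by case: eqP => [iy|]; rewrite ?mulr0//; case: y0; rewrite -iy.
apply/seteqP; split=> [_ [v Vv <-]|w Vw]; first by rewrite derive_shear; exact: Ve.
have h := diff_dir_small t01 Kx.
set d := t * 'd g x e in h *.
have d0 : 1 + d != 0.
  by rewrite gt_eqF//; move: h; rewrite ler_norml => /andP[h _]; lra.
(* This [c] makes w - c e a preimage of w under v + t dg(v) e; the denominator is at least 1/2. *)
pose c := t * 'd g x w / (1 + d).
exists (w + (- c) *: e); first exact: Ve.
rewrite derive_shear -/e.
have E : - c + t * 'd g x (w + (- c) *: e) = 0.
  have -> : 'd g x (w + (- c) *: e) = 'd g x w + - c * 'd g x e.
    by rewrite linearD linearZ.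
  by rewrite /c; rewrite /d in d0 *; field.
by rewrite -addrA -scalerDl E scale0r addr0.
Qed.

End Shear.

(** * Boundary collars and a cutoff *)

Lemma open_coord_gt (R : realType) (m : nat) (c : R) :
  open [set x : 'rV[R]_m | exists i, c < `|x ord0 i|].
Proof.
rewrite (_ : mkset _ = \bigcup_(i in [set: 'I_m])
   ((fun x : 'rV[R]_m => `|x ord0 i|) @^-1` [set u | c < u])); last first.
  by apply/seteqP; split => x [i]; [exists i|exists i].
apply: bigcup_open => i _; apply: open_comp; last exact: open_gt.
move=> x _; apply: (@continuous_comp _ _ _ (fun x : 'rV[R]_m => x ord0 i) Num.norm).
  exact: coord_continuous.
exact: norm_continuous.
Qed.

Section Cutoff.
Context {R : realType} {m : nat}.
Context (eta : R) (eta0 : 0 < eta).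

(** Each face contributes one factor, whose argument runs from 0 to 1 between the depths [eta / 2]
    and [eta]. *)
Definition cutoff (x : 'rV[R]_m) : R^o :=
  \prod_i (step (2 / eta * x ord0 i + (2 / eta - 1)) *
           step (- (2 / eta) * x ord0 i + (2 / eta - 1))).

Lemma smooth_cutoff : smooth cutoff.
Proof. by apply: smooth_prod => i; apply: smoothM; exact: smooth_step_coord. Qed.

Lemma cutoff_ge0 x : 0 <= cutoff x.
Proof. by apply: prodr_ge0 => i _; rewrite mulr_ge0 ?step_ge0. Qed.

Lemma cutoff_le1 x : cutoff x <= 1.
Proof.
apply: prodr_ile1 => i _; rewrite mulr_ge0 ?step_ge0//=.
by rewrite mulr_ile1 ?step_ge0 ?step_le1.
Qed.

Lemma cutoff_eq1 (x : 'rV[R]_m) : (forall i, `|x ord0 i| <= 1 - eta) -> cutoff x = 1.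
Proof.
move=> h; rewrite /cutoff big1// => i _.
have := h i; rewrite ler_norml => /andP[h1 h2]; set c := x ord0 i in h1 h2 *.
have E : 2 / eta * eta = 2 by rewrite divfK// gt_eqF.
have a0 : 0 <= 2 / eta by rewrite divr_ge0// ltW.
set a := 2 / eta in E a0 *.
have k1 := mulr_ge0 a0 (_ : 0 <= c - (- (1 - eta))).
have k2 := mulr_ge0 a0 (_ : 0 <= 1 - eta - c).
rewrite !step_ge1 ?mulr1//.
  by have := k2 ltac:(lra); lra.
by have := k1 ltac:(lra); lra.
Qed.

Lemma cutoff_eq0 (x : 'rV[R]_m) : (exists i, 1 - eta / 2 < `|x ord0 i|) -> cutoff x = 0.
Proof.
move=> [i hi]; rewrite /cutoff (bigD1 i)//=; set c := x ord0 i in hi *.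
have E : 2 / eta * eta = 2 by rewrite divfK// gt_eqF.
have a0 : 0 <= 2 / eta by rewrite divr_ge0// ltW.
set a := 2 / eta in E a0 *.
have [c0|c0] := leP 0 c.
  rewrite ger0_norm// in hi.
  have k : 0 <= a * (c - (1 - eta / 2)) by apply: mulr_ge0 => //; lra.
  by rewrite [step (- a * _ + _)]step_le0 ?mulr0 ?mul0r//; lra.
rewrite ltr0_norm// in hi.
have k : 0 <= a * (- c - (1 - eta / 2)) by apply: mulr_ge0 => //; lra.
by rewrite [step (a * _ + _)]step_le0 ?mul0r//; lra.
Qed.

End Cutoff.

(** * The wiggling isotopy *)

Section Wiggle.
Context {R : realType} {m : nat}.

Definition small_Vhyp_isotopy (eps : R) (F : R -> 'rV[R]_m.+1 -> 'rV[R]_m.+1) :=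
  [/\ isotopy F,
   (exists2 d : R, d < eps &
     forall t, 0 <= t <= 1 -> forall x, cube m.+1 x -> `|F t x - x| <= d),
   (exists U : set 'rV[R]_m.+1, open U /\ cube_bdry m.+1 `<=` U /\
     forall x t, U x -> F t x = x) &
   forall t, 0 <= t <= 1 -> forall x, cube m.+1 x ->
     [set 'D_v (F t) x | v in Vhyp m.+1] = Vhyp m.+1].

Lemma small_Vhyp_isotopy_id eps : 0 < eps -> small_Vhyp_isotopy eps (fun _ x => x).
Proof.
move=> eps0; have E : (fun (_ : R) (x : 'rV[R]_m.+1) => x) = shear (fun=> 0) ord0.
  by apply/funext => t; apply/funext => x; rewrite /shear mulr0 scale0r addr0.
split.
- rewrite E; apply: isotopy_shear => [|//|x _]; first exact: smooth_cst.
  by rewrite pder_cst normr0.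
- by exists 0 => // t _ x _; rewrite subrr normr0.
- by exists setT; split; [exact: openT|].
- move=> t _ x _; apply/seteqP; split=> [_ [v Vv <-]|v Vv].
    by rewrite derive_id.
  by exists v => //; rewrite derive_id.
Qed.

(** The amplitudes are fixed before [l] because the oscillation constants depend on them. The first
    alternative is the collar where [S] will vanish; [2 ^+ r] is the factor gained from [r]
    derivatives of cos(2 x_0 / l). *)
Lemma exists_wiggle (r k : nat) (eta eps : R) : (k < m.+1)%N ->
  0 < eta -> eta <= 1 -> 0 < eps ->
  exists A1 A2 : 'rV[R]_m.+1 -> R^o, [/\ smooth A1, smooth A2 &
    forall l : R, exists2 F, small_Vhyp_isotopy eps F &
      forall x, cube_k m.+1 k x ->
        (exists i, 1 - eta < `|F 1 x ord0 i|) \/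
        A1 (F 1 x) * cos (1 / l * F 1 x ord0 ord0) +
        2 ^+ r * A2 (F 1 x) * cos (2 / l * F 1 x ord0 ord0) = 1].
Proof.
move=> km eta0 eta1 eps0.
have [k0|k0] := posnP k.
  exists (fun=> 1), (fun=> 0); split; [exact: smooth_cst|exact: smooth_cst|].
  move=> l; exists (fun _ x => x); first exact: small_Vhyp_isotopy_id.
  move=> x [_ hx]; right.
  by rewrite hx ?k0// !mulr0 mul0r addr0 cos0 mulr1.
(* This coordinate differs from coordinate 0 because [k] is positive. *)
pose y : 'I_m.+1 := ord_max.
have yn0 : val y <> 0%N by move=> /= m0; move: km; rewrite m0 ltnS leqn0 => /eqP kk; rewrite kk in k0.
have ky : (k <= y)%N by rewrite -ltnS.
have [C C0 hC] := smooth_bounded_cube (smooth_pder y (@smooth_cutoff R m.+1 eta)).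
(* The first bound limits the displacement, the second makes the [y]-derivative of [g] at most 1/2.
   Neither involves [l], since cos(x_0 / l) is constant in direction [y]. *)
pose del : R := Num.min (eps / 2) (1 / (2 * (C + 1))).
have C1 : 0 < 2 * (C + 1) by rewrite mulr_gt0// ltr_wpDl.
have del0 : 0 < del by rewrite lt_min !divr_gt0.
have dele : del <= eps / 2 by rewrite ge_min lexx.
have delC : del * C <= 1 / 2.
  have : del <= 1 / (2 * (C + 1)) by rewrite ge_min lexx orbT.
  rewrite ler_pdivlMr// => h; lra.
exists (fun x => (2 / del : R) * x ord0 y : R), (fun=> - (2 ^+ r)^-1); split.
- by apply: smoothM; [exact: smooth_cst|exact: smooth_coord].
- exact: smooth_cst.
move=> l; pose g (x : 'rV[R]_m.+1) : R^o :=
  (del : R) *: (cutoff eta x * cos (1 / l * x ord0 ord0 + 0) : R^o).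
have sgc : smooth (fun x : 'rV[R]_m.+1 => cutoff eta x * cos (1 / l * x ord0 ord0 + 0) : R^o).
  by apply: smoothM; [exact: smooth_cutoff|exact: smooth_cos_coord].
have sg : smooth g by exact: (@smoothZ _ _ R^o).
have cos1 (a : R) : `|cos a| <= 1 by rewrite ler_norml cos_geN1 cos_le1.
have g0 (x : 'rV[R]_m.+1) : (exists i, 1 - eta / 2 < `|x ord0 i|) -> g x = 0.
  by move=> h; rewrite /g cutoff_eq0// mul0r scaler0.
have hbd : forall (x : 'rV[R]_m.+1) i, `|x ord0 i| = 1 -> g x = 0.
  by move=> x i hi; apply: g0; exists i; rewrite hi ltrBlDr ltrDl divr_gt0.
have hd x : cube m.+1 x -> `|pder y g x| <= 1 / 2.
  move=> Kx; rewrite /g pderZ; last by move=> z; exact: smooth_diff.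
  rewrite pderM; last 2 first.
    by move=> z; apply: smooth_diff; exact: smooth_cutoff.
    by move=> z; apply: smooth_diff; exact: smooth_cos_coord.
  rewrite pder_cos_coord (_ : (ord0 == y) = false); last first.
    by apply/eqP => h; apply: yn0; rewrite -h.
  rewrite mulr0 mul0r mulr0 add0r normrZ gtr0_norm//.
  apply: le_trans delC; apply: ler_wpM2l; first exact: ltW.
  by rewrite normrM -[leRHS]mulr1; apply: ler_pM => //; exact: hC.
have hg x : `|g x| <= del.
  rewrite /g normrZ gtr0_norm// -[leRHS]mulr1; apply: ler_wpM2l; first exact: ltW.
  rewrite normrM -[leRHS]mulr1; apply: ler_pM => //.
  by rewrite ger0_norm ?cutoff_ge0 ?cutoff_le1.
exists (shear g y); first split.
- by apply: isotopy_shear => // x _; exact: hbd.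
- exists del; first lra.
  move=> t /andP[t0 t1] x Kx; rewrite /shear addrC addKr normrZ.
  rewrite -[leRHS]mulr1; apply: ler_pM => //.
    by apply: le_trans (hg x); rewrite normrM ler_piMl// ger0_norm.
  by apply: rV_norm_le => // i; rewrite coord_evec; case: (i == y); rewrite ?normr1 ?normr0.
- exists [set x : 'rV[R]_m.+1 | exists i, 1 - eta / 2 < `|x ord0 i|]; split; first exact: open_coord_gt.
  split=> [x [_ [i hi]]|x t Ux]; first by exists i; rewrite hi ltrBlDr ltrDl divr_gt0.
  by rewrite /shear g0// mulr0 scale0r addr0.
- move=> t t01 x Kx; apply: derive_shear_Vhyp => //.
move=> x [Kx hx]; have xy : x ord0 y = 0 by exact: hx.
(* Collar points of I^k stay in the collar: their large coordinate is not [y], which is 0, and the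
   shear fixes all the others. *)
have [[i hi]|hn] := pselect (exists i, 1 - eta < `|x ord0 i|).
  left; exists i; rewrite shear_coord//; apply/eqP => iy.
  by move: hi; rewrite iy xy normr0; lra.
right; have x0 : shear g y 1 x ord0 ord0 = x ord0 ord0.
  by rewrite shear_coord//; apply/eqP => h; apply: yn0; rewrite -h.
rewrite x0 shear_coord_dir xy add0r mul1r /g cutoff_eq1 //; last first.
  by move=> i; rewrite leNgt; apply/negP => h; apply: hn; exists i.
rewrite [1 * cos _]mul1r addr0; set c := x ord0 ord0.
have -> : 2 / l * c = (1 / l * c) + (1 / l * c) by rewrite -mulrDl -mulrDl.
rewrite cosD; have := cos2Dsin2 (1 / l * c); set a := cos _; set b := sin _ => ab.
rewrite /GRing.scale /= mulrA divfK ?gt_eqF//.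
rewrite mulrN divff ?expf_neq0 ?pnatr_eq0//.
rewrite !expr2 in ab; lra.
Qed.

End Wiggle.

(** * Constants uniform in the output coordinate; jets of vector-valued maps *)

Lemma uniform_support (R : realType) (m n : nat) (S : 'I_n -> 'rV[R]_m -> R) :
  (forall j, exists2 eta : R, 0 < eta &
     forall x : 'rV[R]_m, (exists i, 1 - eta < `|x ord0 i|) -> S j x = 0) ->
  exists2 eta : R, 0 < eta <= 1 &
    forall j (x : 'rV[R]_m), (exists i, 1 - eta < `|x ord0 i|) -> S j x = 0.
Proof.
move=> h.
have h' : \forall eta \near (0 : R)^'+, forall j (x : 'rV[R]_m),
    (exists i, 1 - eta < `|x ord0 i|) -> S j x = 0.
  apply: filter_forall => j; have [e e0 he] := h j.
  near=> eta; move=> x [i hi]; apply: he; exists i; apply: le_lt_trans hi.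
  by rewrite lerD2l lerN2; near: eta; exact: nbhs_right_le.
near (0 : R)^'+ => eta; exists eta; last exact: (near h' eta).
apply/andP; split; first by near: eta; exact: nbhs_right_gt.
by near: eta; exact: nbhs_right_le.
Unshelve. all: by end_near. Qed.

Section Main.
Context {R : realType} {m n : nat}.

Lemma smooth_row (f : 'I_n -> 'rV[R]_m -> R^o) :
  (forall j, smooth (f j)) -> smooth (fun x => \row_j f j x).
Proof.
move=> sf; rewrite (_ : (fun x => _) = fun x => \sum_j (f j x : R) *: evec j).
  by apply: smooth_sum => j; exact: smoothZl.
apply/funext => x; rewrite [LHS]row_sum_delta.
by apply: eq_bigr => j _; rewrite mxE.
Qed.

Lemma jet_row (f : 'I_n -> 'rV[R]_m -> R^o) x a j :
  jet (fun x => \row_j f j x) x a j = iter_pder (mindex_seq a) (f j) x.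
Proof.
rewrite /jet /pder_multi -/(mindex_seq a); congr (iter_pder _ _ _).
by apply/funext => z; rewrite mxE.
Qed.

End Main.

Lemma finite_bound (R : realType) (n : nat) (P : 'I_n -> R -> Prop) :
  (forall j c d, c <= d -> P j c -> P j d) ->
  (forall j, exists2 c, 0 <= c & P j c) ->
  exists2 c, 0 <= c & forall j, P j c.
Proof.
move=> mono hP.
have /choice[c hc] : forall j, exists c, 0 <= c /\ P j c.
  by move=> j; have [c] := hP j; exists c.
exists (\sum_j c j).
  by apply: sumr_ge0 => j _; have [] := hc j.
move=> j; have [cj Pj] := hc j; apply: mono Pj.
by rewrite (bigD1 j)//= lerDl sumr_ge0// => i _; have [] := hc i.
Qed.

(** * Assembly of the section and the final estimates *)

Unset Implicit Arguments.
Set Strict Implicit.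

Theorem mainTheorem14 (R : realType) (m n r k : nat) (hkm : (k < m)%N)
  (sigma : jsection R m n)
  (sigma_cont : forall (a : 'I_m -> nat) (j : 'I_n), (mdeg a <= r)%N ->
     {within cube m, continuous (fun x => sigma x a j)})
  (sigma_bdry : exists U : set 'rV[R]_m, open U /\ cube_bdry m `<=` U /\
     forall x, U x -> cube m x ->
       forall (a : 'I_m -> nat) (j : 'I_n), (mdeg a <= r)%N -> sigma x a j = 0)
  (sigma_perp : forall x, cube m x ->
     forall (a : 'I_m -> nat) (j : 'I_n), perp_index r a -> sigma x a j = 0)
  (eps : R) (heps : 0 < eps) :
  exists (F : R -> 'rV[R]_m -> 'rV[R]_m) (h : 'rV[R]_m -> 'rV[R]_n),
    isotopy F /\ smooth h /\
     (* dist(sigmahat, sigma) < eps on an open neighbourhood of F_1(I^k) *)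
     (exists U : set 'rV[R]_m, open U /\ F 1 @` cube_k m k `<=` U /\
        exists2 d : R, d < eps &
          forall x, U x -> cube m x ->
            forall (a : 'I_m -> nat) (j : 'I_n), (mdeg a <= r)%N ->
              `|jet h x a j - sigma x a j| <= d) /\
     (* ||sigmahat^perp||_C0 < eps on I^m *)
     (exists2 d : R, d < eps &
        forall x, cube m x ->
          forall (a : 'I_m -> nat) (j : 'I_n), perp_index r a ->
            `|jet h x a j| <= d) /\
     (* dist_C0(F_t, id) < eps *)
     (exists2 d : R, d < eps &
        forall t, 0 <= t <= 1 -> forall x, cube m x -> `|F t x - x| <= d) /\
     (* F_t = id and sigmahat = 0 near the boundary *)
     (exists U : set 'rV[R]_m, open U /\ cube_bdry m `<=` U /\
        forall x, U x -> cube m x ->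
          (forall t, 0 <= t <= 1 -> F t x = x) /\
          (forall (a : 'I_m -> nat) (j : 'I_n), (mdeg a <= r)%N -> jet h x a j = 0)) /\
     (* V is invariant: dF_t(V) = V *)
     (forall t, 0 <= t <= 1 -> forall x, cube m x ->
        [set 'D_v (F t) x | v in Vhyp m] = Vhyp m).
Proof.
case: m hkm sigma sigma_cont sigma_bdry sigma_perp => [//|m] hkm sigma sigma_cont
  [V [oV [bV sV]]] sigma_perp.
(* The pure derivative: the only multi-index of degree at most [r] that is not a [perp_index]. *)
pose a0 (i : 'I_m.+1) := if val i == 0%N then r else 0%N.
have ha0 : (mdeg a0 <= r)%N.
  by rewrite /mdeg (bigD1 ord0)//= big1 ?addn0// => i; rewrite /a0 -val_eqE /= => /negbTE ->.
(* Three errors of at most [eps / 8] will add up: the approximation of [sigma], the oscillation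
   remainder, and the deviation of [E] from 1. *)
have eps8 : 0 < eps / 8 by rewrite divr_gt0.
have /choice[S hS] : forall j, exists S : 'rV[R]_m.+1 -> R^o, smooth S /\
    (forall x, cube m.+1 x -> `|S x - sigma x a0 j| <= eps / 8) /\
    exists2 eta : R, 0 < eta &
      forall x : 'rV[R]_m.+1, (exists i, 1 - eta < `|x ord0 i|) -> S x = 0.
  move=> j; apply: (smooth_approx (sigma_cont _ j ha0) oV bV) => // x Vx Kx.
  exact: sV.
have [eta /andP[eta0 eta1] Seta] := uniform_support (fun j => (hS j).2.2).
have sS j : smooth (S j) := (hS j).1.
have [A1 [A2 [sA1 sA2 wiggle]]] := exists_wiggle r hkm eta0 eta1 heps.
have sSA1 j : smooth (fun x => S j x * A1 x : R^o) by exact: smoothM.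
have sSA2 j : smooth (fun x => S j x * A2 x : R^o) by exact: smoothM.
pose q : R := - ((pi / 2) *+ r).
pose h_ l j (x : 'rV[R]_m.+1) : R^o := osc ord0 1 l r (fun x => S j x * A1 x : R^o) q x +
  osc ord0 2 l r (fun x => S j x * A2 x : R^o) q x.
have sh l j : smooth (h_ l j) by apply: smoothD; exact: smooth_osc.
(* The coefficient of [S j] in the leading part of the pure derivative; it equals 1 on F_1(I^k)
   outside the collar. *)
pose E l (x : 'rV[R]_m.+1) : R^o :=
  A1 x * cos (1 / l * x ord0 ord0) + 2 ^+ r * A2 x * cos (2 / l * x ord0 ord0).
(* [C] is independent of [l], so [l] can be chosen afterwards with [C * l <= eps / 8]. *)
have [C C0 hC] : exists2 C : R, 0 <= C & forall j l x, 0 < l -> l <= 1 -> cube m.+1 x ->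
    (forall s, (size s <= r)%N -> s <> nseq r ord0 -> `|iter_pder s (h_ l j) x| <= C * l) /\
    `|iter_pder (nseq r ord0) (h_ l j) x - S j x * E l x| <= C * l.
  apply: (@finite_bound _ _ (fun j C => forall l x, 0 < l -> l <= 1 -> cube m.+1 x ->
    (forall s, (size s <= r)%N -> s <> nseq r ord0 -> `|iter_pder s (h_ l j) x| <= C * l) /\
    `|iter_pder (nseq r ord0) (h_ l j) x - S j x * E l x| <= C * l)).
    move=> j c d cd h l x l0 l1 Kx; have [h1 h2] := h l x l0 l1 Kx.
    have cdl : c * l <= d * l by rewrite ler_wpM2r// ltW.
    split=> [s ss sn|]; last exact: le_trans h2 cdl.
    exact: le_trans (h1 s ss sn) cdl.
  move=> j; have [C1 C10 h1] := osc_estimate ord0 1 r (sSA1 j).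
  have [C2 C20 h2] := osc_estimate ord0 2 r (sSA2 j).
  exists (C1 + C2) => [|l x l0 l1 Kx]; first by rewrite addr_ge0.
  have [h1a h1b] := h1 l x l0 l1 Kx; have [h2a h2b] := h2 l x l0 l1 Kx.
  have hE s : iter_pder s (h_ l j) x = iter_pder s (osc ord0 1 l r (fun x => S j x * A1 x : R^o) q) x
      + iter_pder s (osc ord0 2 l r (fun x => S j x * A2 x : R^o) q) x.
    by rewrite /h_ iter_pderD//; exact: smooth_osc.
  split=> [s ss sn|].
    rewrite hE mulrDl; apply: (le_trans (ler_normD _ _)).
    by apply: lerD; [exact: h1a|exact: h2a].
  rewrite hE mulrDl; apply: le_trans (lerD h1b h2b).
  apply: le_trans (ler_normD _ _); rewrite le_eqVlt; apply/orP; left; apply/eqP.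
  by congr (`|_|); rewrite /E expr1n; ring.
have [CS CS0 hCS] : exists2 C : R, 0 <= C & forall j x, cube m.+1 x -> `|S j x| <= C.
  apply: (@finite_bound _ _ (fun j C => forall x, cube m.+1 x -> `|S j x| <= C)).
    by move=> j c d cd h x Kx; exact: le_trans (h x Kx) cd.
  by move=> j; exact: smooth_bounded_cube.
pose l : R := Num.min 1 (eps / 8 / (C + 1)).
have C1 : 0 < C + 1 by rewrite ltr_wpDl.
have l0 : 0 < l by rewrite lt_min ltr01 divr_gt0.
have l1 : l <= 1 by rewrite ge_min lexx.
have Cl : C * l <= eps / 8.
  have : l <= eps / 8 / (C + 1) by rewrite ge_min lexx orbT.
  by rewrite ler_pdivlMr// => h; lra.
have [F [isoF distF [W [oW [bW hW]]] VF] hF] := wiggle l.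
exists F, (fun x => \row_j h_ l j x).
pose Z : set 'rV[R]_m.+1 := [set x | exists i, 1 - eta < `|x ord0 i|].
have oZ : open Z by exact: open_coord_gt.
have jetZ x a j : Z x -> jet (fun x => \row_j h_ l j x) x a j = 0.
  move=> Zx; rewrite jet_row; apply: (iter_pder_near0 _ oZ) Zx => z Zz.
  by rewrite /h_ /osc Seta// !mul0r !scaler0 addr0.
have jet_perp x a j : cube m.+1 x -> perp_index r a ->
    `|jet (fun x => \row_j h_ l j x) x a j| <= eps / 8.
  move=> Kx pa; rewrite jet_row; apply: le_trans Cl.
  have [h _] := hC j l x l0 l1 Kx; apply: h; last exact: perp_index_seq.
  by rewrite size_mindex_seq; case: pa.
have d_lt : eps / 2 < eps by lra.
split=> //; split; first exact: smooth_row.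
split.
  have sE : smooth (E l).
    have -> : E l = fun x => A1 x * cos (1 / l * x ord0 ord0 + 0) +
        2 ^+ r * A2 x * cos (2 / l * x ord0 ord0 + 0).
      by apply/funext => x; rewrite !addr0.
    apply: smoothD; apply: smoothM => //; try exact: smooth_cos_coord.
    by apply: smoothM => //; exact: smooth_cst.
  have CS1 : 0 < CS + 1 by rewrite ltr_wpDl.
  (* As |S j| <= CS on the cube, a deviation of [E l] from 1 by at most [c] costs at most
     [eps / 8]. *)
  pose c := eps / 8 / (CS + 1).
  have c0 : 0 < c by rewrite divr_gt0.
  (* The collar together with the region where [E l] is close to 1 contains F_1(I^k). *)
  exists (Z `|` (E l) @^-1` (ball (1 : R) c)); split.
    apply: openU => //; apply: open_comp; last exact: ball_open.
    by move=> x _; exact: smooth_continuous.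
  split=> [_ [x Kx <-]|].
    case: (hF x Kx) => [?|hE]; [by left|right].
    by rewrite /= /E hE; exact: ballxx.
  exists (eps / 2) => // x Ux Kx a j ha.
  have [pa|npa] := pselect (perp_index r a).
    by rewrite (sigma_perp x Kx a j pa) subr0; apply: le_trans (jet_perp _ _ _ Kx pa) _; lra.
  have [aE sE0] := not_perp_index_seq ha npa.
  have [_ [/(_ x Kx) hSs _]] := hS j.
  rewrite -/a0 in aE; rewrite aE in sE0 *.
  (* In the collar the jet and [S j] both vanish, so [sigma] itself is within [eps / 8] of 0. *)
  case: Ux => [Zx|].
    rewrite jetZ// sub0r normrN.
    by move: hSs; rewrite Seta// sub0r normrN => /le_trans; apply; lra.
  rewrite /= -ball_normE /= => hE1.
  rewrite jet_row sE0.
  have [_ h] := hC j l x l0 l1 Kx.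
  have h2 : `|S j x * E l x - S j x| <= eps / 8.
    rewrite -{2}[S j x]mulr1 -mulrBr normrM.
    have : `|E l x - 1| <= c by rewrite distrC ltW.
    move=> /(ler_pM (normr_ge0 _) (normr_ge0 _) (hCS j x Kx)) /le_trans; apply.
    by rewrite /c mulrA ler_pdivrMr//; nra.
  set T := iter_pder _ _ _ in h *.
  have -> : T - sigma x a0 j = (T - S j x * E l x) + (S j x * E l x - S j x) +
    (S j x - sigma x a0 j) by ring.
  apply: (le_trans (ler_normD _ _)).
  have := ler_normD (T - S j x * E l x) (S j x * E l x - S j x).
  by lra.
split.
  exists (eps / 2) => // x Kx a j pa.
  by apply: le_trans (jet_perp _ _ _ Kx pa) _; lra.
split=> //; split=> //.
exists (W `&` Z); split; first exact: openI.
split=> [x bx|x [Wx Zx] Kx].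
  by split; [exact: bW|case: bx => _ [i hi]; exists i; rewrite hi; lra].
by split=> [t t01|a j _]; [exact: hW|exact: jetZ].
Qed.
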